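(* Assume that $R=\mathbb K[x_1]_p[x_2;\sigma_2,\delta_2]_p\cdots[x_N;\sigma_N,\delta_N]_p$ is a Poisson-CGL extension of length $N$ with torus $\mathcal H$, and $k\in[1,N-1]$ is such that $\delta_{k+1}(x_k)\in\mathbb K$. Denote by $y_1,\dots,y_N$ and $\eta:[1,N]\to\mathbb Z$ the associated sequence of homogeneous Poisson-prime elements and function. Assume that $R$ has a second Poisson-CGL extension presentation (for the same torus $\mathcal H$) of the form $$R=\mathbb K[x_1]_p\cdots[x_{k-1};\sigma_{k-1},\delta_{k-1}]_p[x_{k+1};\sigma'_k,\delta'_k]_p[x_k;\sigma'_{k+1},\delta'_{k+1}]_p[x_{k+2};\sigma_{k+2},\delta_{k+2}]_p\cdots[x_N;\sigma_N,\delta_N]_p,$$ and let $y'_1,\dots,y'_N$ be the sequence of homogeneous Poisson-prime elements associated to the second presentation. Put $y_{-\infty}:=1$ and $R_{k-1}=\mathbb K[x_1,\dots,x_{k-1}]$. (a) If $\eta(k)\neq\eta(k+1)$, then $y'_j=y_j$ for $j\neq k,k+1$, and $y'_k=y_{k+1}$, $y'_{k+1}=y_k$. (b) If $\eta(k)=\eta(k+1)$, then $y_ky'_k-y_{p(k)}y_{k+1}$ is a homogeneous Poisson-normal element of $R_{k-1}$. It Poisson-normalizes the elements of $R_{k-1}$ in exactly the same way as $y_{p(k)}y_{k+1}$. Furthermore, $y'_j=y_j$ for all $j\in[1,N]$, $j\ne k$. In both cases (a) and (b), the function $\eta':[1,N]\to\mathbb Z$ associated to the second presentation can be chosen to be $\eta'=\eta\,(k,k+1)$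 (composition with the transposition $(k,k+1)\in S_N$). In particular, the ranges of $\eta$ and $\eta'$ coincide and the rank of $R$ is the same for both presentations.
   Context: $\mathbb K$ is a field of characteristic $0$; algebras are $\mathbb K$-algebras, derivations are $\mathbb K$-linear; $[j,k]=\{j,\dots,k\}$. A Poisson algebra is a commutative algebra with a Lie bracket $\{-,-\}$ that is a derivation in each variable. A Poisson action is an action by algebra automorphisms preserving the bracket. A Poisson derivation $\sigma$ of $B$ is a derivation for both product and bracket; a Poisson $\sigma$-derivation is a derivation $\delta$ for the product with $\delta(\{a,b\})=\{\delta(a),b\}+\{a,\delta(b)\}+\sigma(a)\delta(b)-\delta(a)\sigma(b)$. The Poisson-Ore extension $B[x;\sigma,\delta]_p$ is $B[x]$ with the unique Poisson bracket extending that of $B$ with $\{x,b\}=\sigma(b)x+\delta(b)$. For a rational action of a torus $\mathcal H\cong(\mathbb K^* )^r$, homogeneous elements are the $\mathcal H$-eigenvectors and $0$; $\mathrm{Lie}\,\mathcal H\cong\mathbb K^r$ acts by the differential: if $a$ is an $\mathcal H$-eigenvector with eigenvalue $h\mapsto h_1^{u_1}\cdots h_r^{u_r}$, then $\xi\cdot a=(u_1\xi_1+\dots+u_r\xi_r)a$. An element $c$ of a Poisson algebra $A$ is Poisson-normal if $\{c,A\}\subseteq Ac$. A Poisson-prime element of a Poisson domain $A$ is a nonzero Poisson-normal $c$ with $A/(c)$ a domain. An element $u\neq 0$ of $R$ Poisson-normalizes elements of $R_{k-1}$ via a derivation $\partial$ of $R_{k-1}$ if $\{u,a\}=\partial(a)u$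 for all $a\in R_{k-1}$; two elements Poisson-normalize ''in exactly the same way'' if they do so with the same $\partial$. A Poisson-CGL (P-CGL) extension of length $N$ is an iterated Poisson-Ore extension $R=\mathbb K[x_1]_p[x_2;\sigma_2,\delta_2]_p\cdots[x_N;\sigma_N,\delta_N]_p$ ($\sigma_1=\delta_1=0$; $R_k:=\mathbb K[x_1,\dots,x_k]$, $R_0=\mathbb K$) with a rational Poisson action of a torus $\mathcal H$ such that (i) each $x_k$ is an $\mathcal H$-eigenvector; (ii) for $k\in[2,N]$, $\delta_k$ is a locally nilpotent Poisson $\sigma_k$-derivation of $R_{k-1}$; (iii) for $k\in[1,N]$ there is $h_k\in\mathrm{Lie}\,\mathcal H$ with $\sigma_k=(h_k\cdot)|_{R_{k-1}}$ and the $h_k$-eigenvalue $\lambda_k$ of $x_k$ is nonzero. The rank of $R$ is the number of homogeneous Poisson-prime elements of $R$ up to scalar multiples. For $\eta:[1,N]\to\mathbb Z$: $p(k)=\max\{j<k\mid\eta(j)=\eta(k)\}$, $s(k)=\min\{j>k\mid\eta(j)=\eta(k)\}$ ($\max\varnothing=-\infty$, $\min\varnothing=+\infty$). For every P-CGL extension there exist $\eta$ and homogeneous $c_k\in R_{k-1}$ (for $p(k)\neq-\infty$) such that the elements $y_k:=y_{p(k)}x_k-c_k$ if $p(k)\ne-\infty$, $y_k:=x_k$ if $p(k)=-\infty$, are homogeneous and for every $k$ the set $\{y_j\mid j\in[1,k],\,s(j)>k\}$ is a list of the homogeneous Poisson-prime elements of $R_k$ up to scalar multiples; the $y_k$, the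 level sets of $\eta$, and $p,s$ are uniquely determined by the presentation. These are the sequence and function ''associated to'' a presentation (for the second presentation, $x_{k+1}$ is the $k$-th and $x_k$ the $(k+1)$-st adjoined variable). *)

(* Defs.v *)
From HB Require Import structures.
From mathcomp Require Import all_boot all_order all_algebra all_fingroup.

Set Implicit Arguments.
Unset Strict Implicit.
Unset Printing Implicit Defensive.

Import GRing.Theory.
Local Open Scope ring_scope.

(* Subalgebras and subspaces of an ambient algebra R are predicates on R; maps
   defined on a subalgebra are functions R -> R of which only the values on
   that subalgebra matter. *)

Section Algebra.
Variables (K : fieldType) (R : comAlgType K).
Implicit Types (A B C S : R -> Prop) (D s d : R -> R) (br : R -> R -> R).

Inductive gen_alg S : R -> Prop :=
| gen_scalar (c : K) : gen_alg S (c%:A)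
| gen_mem a : S a -> gen_alg S a
| gen_add a b : gen_alg S a -> gen_alg S b -> gen_alg S (a + b)
| gen_mul a b : gen_alg S a -> gen_alg S b -> gen_alg S (a * b).

Definition whole : R -> Prop := fun _ => True.

Record derivation_on A D : Prop := DerivationOn {
  der_stable : forall a, A a -> A (D a);
  der_linear : forall (c : K) a b, A a -> A b ->
    D (c *: a + b) = c *: D a + D b;
  der_mul : forall a b, A a -> A b -> D (a * b) = D a * b + a * D b }.

Record is_poisson br : Prop := IsPoisson {
  br_linear : forall (c : K) a b z, br (c *: a + b) z = c *: br a z + br b z;
  br_alt : forall a, br a a = 0;
  br_jacobi : forall a b z, br a (br b z) + br b (br z a) + br z (br a b) = 0;
  br_leibniz : forall a b z, br (a * b) z = br a z * b + a * br b z }.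

Definition poisson_derivation_on br A D : Prop :=
  derivation_on A D /\
  forall a b, A a -> A b -> D (br a b) = br (D a) b + br a (D b).

Definition poisson_sigma_derivation_on br A s d : Prop :=
  derivation_on A d /\
  forall a b, A a -> A b ->
    d (br a b) = br (d a) b + br a (d b) + s a * d b - d a * s b.

Definition locally_nilpotent_on A d : Prop :=
  forall a, A a -> exists n, iter n d a = 0.

Definition is_poly_ring B (x : R) C : Prop :=
  (forall a, C a <-> exists2 p : {poly R}, (forall n, B p`_n) & a = p.[x]) /\
  (forall p : {poly R}, (forall n, B p`_n) -> p.[x] = 0 -> p = 0).

(* C = B[x; s, d]_p as Poisson subalgebras of R. *)
Record poisson_ore br B (x : R) s d C : Prop := PoissonOre {
  ore_poly : is_poly_ring B x C;
  ore_sigma : poisson_derivation_on br B s;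
  ore_delta : poisson_sigma_derivation_on br B s d;
  ore_bracket : forall b, B b -> br x b = s b * x + d b }.

(* a belongs to the principal ideal of A generated by c. *)
Definition in_principal A (c a : R) : Prop := exists2 b, A b & a = b * c.

Definition poisson_normal br A (c : R) : Prop :=
  A c /\ forall a, A a -> in_principal A c (br c a).

(* The last two clauses say that A/(c) is a domain: it is nonzero and has no
   zero divisors. *)
Record poisson_prime br A (c : R) : Prop := PoissonPrime {
  prime_neq0 : c <> 0;
  prime_normal : poisson_normal br A c;
  prime_proper : ~ in_principal A c 1;
  prime_domain : forall a b, A a -> A b -> in_principal A c (a * b) ->
    in_principal A c a \/ in_principal A c b }.

Definition normalizes_via br B (u : R) D : Prop :=
  u <> 0 /\ forall a, B a -> br u a = D a * u.

Definition normalize_same_way br B (u v : R) : Prop :=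
  exists D, [/\ derivation_on B D, normalizes_via br B u D
              & normalizes_via br B v D].

End Algebra.

(* The torus: the vectors of K^r with all entries nonzero. *)

Definition in_torus (K : fieldType) (r : nat) (h : {ffun 'I_r -> K}) : Prop :=
  forall i, h i != 0.

Definition torus_char (K : fieldType) (r : nat) (u : {ffun 'I_r -> int})
    (h : {ffun 'I_r -> K}) : K :=
  \prod_(i < r) h i ^ u i.

(* Regular functions on the torus, i.e. Laurent polynomials. *)
Definition torus_regular (K : fieldType) (r : nat)
    (f : {ffun 'I_r -> K} -> K) : Prop :=
  exists l : seq (K * {ffun 'I_r -> int}),
    forall h, in_torus h -> f h = \sum_(t <- l) t.1 * torus_char t.2 h.

Section TorusAction.
Variables (K : fieldType) (r : nat) (R : comAlgType K).
Variables (br : R -> R -> R) (act : {ffun 'I_r -> K} -> R -> R).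

Record poisson_action : Prop := PoissonAction {
  act_one : forall a, act [ffun=> 1] a = a;
  act_comp : forall g h a, in_torus g -> in_torus h ->
    act [ffun i => g i * h i] a = act g (act h a);
  act_linear : forall h (c : K) a b, in_torus h ->
    act h (c *: a + b) = c *: act h a + act h b;
  act_mul1 : forall h, in_torus h -> act h 1 = 1;
  act_mul : forall h a b, in_torus h -> act h (a * b) = act h a * act h b;
  act_br : forall h a b, in_torus h ->
    act h (br a b) = br (act h a) (act h b) }.

(* Every element lies in a finite-dimensional stable subspace (with basis v)
   on which the torus acts by matrices whose entries are regular functions. *)
Definition rational_action : Prop :=
  forall a : R, exists (n : nat) (v : 'I_n -> R)
      (f : 'I_n -> 'I_n -> {ffun 'I_r -> K} -> K),
    [/\ forall c : 'I_n -> K, \sum_i c i *: v i = 0 -> forall i, c i = 0,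
        exists c : 'I_n -> K, a = \sum_i c i *: v i,
        forall i j, torus_regular (f i j)
      & forall h j, in_torus h -> act h (v j) = \sum_i f i j h *: v i].

Definition eigenvector (a : R) : Prop :=
  a <> 0 /\ forall h, in_torus h -> exists c : K, act h a = c *: a.

Definition homogeneous (a : R) : Prop := a = 0 \/ eigenvector a.

Definition has_weight (u : {ffun 'I_r -> int}) (a : R) : Prop :=
  forall h, in_torus h -> act h a = torus_char u h *: a.

(* D is the action on R of the element xi of Lie H = K^r. *)
Definition is_lie_action (xi : 'I_r -> K) (D : R -> R) : Prop :=
  (forall (c : K) a b, D (c *: a + b) = c *: D a + D b) /\
  (forall u a, has_weight u a -> D a = (\sum_(i < r) (u i)%:~R * xi i) *: a).

(* The y j with I j list the homogeneous Poisson-prime elements of A up to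
   scalar multiples, without repetition. *)
Definition lists_homogeneous_primes (A : R -> Prop) (T : finType)
    (I : pred T) (y : T -> R) : Prop :=
  [/\ forall j, I j -> homogeneous (y j) /\ poisson_prime br A (y j),
      forall c, homogeneous c -> poisson_prime br A c ->
        exists2 j, I j & exists2 a : K, a != 0 & c = a *: y j
    & forall i j, I i -> I j ->
        (exists2 a : K, a != 0 & y i = a *: y j) -> i = j].

Definition has_rank (n : nat) : Prop :=
  exists y : 'I_n -> R, lists_homogeneous_primes (@whole K R) predT y.

End TorusAction.

(* Indices are 0-based: the i-th adjoined variable is x i with i = 0, ..., N-1,
   and partial_alg x m is generated by the first m variables. In particular
   sigma i and delta i are maps on partial_alg x i. *)

Definition partial_alg (K : fieldType) (R : comAlgType K) (N : nat)
    (x : 'I_N -> R) (m : nat) : R -> Prop :=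
  gen_alg (fun a => exists2 j : 'I_N, (j < m)%N & a = x j).

(* For i = 0, poisson_ore forces sigma and delta to vanish on K. *)
Record is_pcgl (K : fieldType) (r : nat) (R : comAlgType K)
    (br : R -> R -> R) (act : {ffun 'I_r -> K} -> R -> R)
    (N : nat) (x : 'I_N -> R) (sigma delta : 'I_N -> R -> R) : Prop := IsPCGL {
  pcgl_poisson : is_poisson br;
  pcgl_full : forall a, partial_alg x N a;
  pcgl_ore : forall i : 'I_N,
    poisson_ore br (partial_alg x i) (x i) (sigma i) (delta i)
                   (partial_alg x i.+1);
  pcgl_action : poisson_action br act;
  pcgl_rational : rational_action act;
  pcgl_eigen : forall i, eigenvector act (x i);
  pcgl_nilpotent : forall i : 'I_N,
    locally_nilpotent_on (partial_alg x i) (delta i);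
  pcgl_lie : forall i : 'I_N, exists (xi : 'I_r -> K) (D : R -> R),
    [/\ is_lie_action act xi D,
        forall b, partial_alg x i b -> sigma i b = D b
      & exists2 lambda : K, lambda != 0 & D (x i) = lambda *: x i] }.

(* p(k) and s(k); None stands for -oo and +oo respectively. *)

Definition eta_pred (N : nat) (eta : 'I_N -> int) (k : 'I_N) : option 'I_N :=
  [pick j : 'I_N | [&& (j < k)%N, eta j == eta k
     & [forall i : 'I_N, (i < k)%N && (eta i == eta k) ==> (i <= j)%N]]].

Definition eta_succ (N : nat) (eta : 'I_N -> int) (k : 'I_N) : option 'I_N :=
  [pick j : 'I_N | [&& (k < j)%N, eta j == eta k
     & [forall i : 'I_N, (k < i)%N && (eta i == eta k) ==> (j <= i)%N]]].

Definition succ_gt (N : nat) (eta : 'I_N -> int) (j k : 'I_N) : bool :=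
  if eta_succ eta j is Some i then (k < i)%N else true.

(* y_{p(k)}, with y_{-oo} = 1. *)
Definition y_pred (K : fieldType) (R : comAlgType K) (N : nat)
    (eta : 'I_N -> int) (y : 'I_N -> R) (k : 'I_N) : R :=
  if eta_pred eta k is Some j then y j else 1.

Definition associated (K : fieldType) (r : nat) (R : comAlgType K)
    (br : R -> R -> R) (act : {ffun 'I_r -> K} -> R -> R) (N : nat)
    (x : 'I_N -> R) (eta : 'I_N -> int) (y : 'I_N -> R) : Prop :=
  exists c : 'I_N -> R,
    [/\ forall k : 'I_N, eta_pred eta k != None ->
          homogeneous act (c k) /\ partial_alg x k (c k),
        forall k : 'I_N,
          y k = (if eta_pred eta k is Some j then y j * x k - c k else x k),
        forall k : 'I_N, homogeneous act (y k)
      & forall k : 'I_N,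
          lists_homogeneous_primes br act (partial_alg x k.+1)
            [pred j : 'I_N | (j <= k)%N && succ_gt eta j k] y].

Definition num_values (N : nat) (eta : 'I_N -> int) : nat :=
  size (undup (codom eta)).

(* Main.v *)
Require Import Defs.
From HB Require Import structures.
From mathcomp Require Import all_boot all_order all_algebra all_fingroup.
From mathcomp Require Import ring zify.
From Stdlib Require Import ClassicalEpsilon.

Set Implicit Arguments.
Unset Strict Implicit.
Unset Printing Implicit Defensive.

Import GRing.Theory.
Local Open Scope ring_scope.

(** Write A_m for the algebra generated by the first m variables. The list of
    homogeneous Poisson-primes of A_m depends on A_m only, not on the order in
    which its variables were adjoined, and y_j is, up to a scalar, the only
    homogeneous Poisson-prime of A_(j+1) that is not in A_j (new_prime). The two
    presentations have the same A_m except for m = k + 1, so y'_j is a multiple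
    of y_j for j different from k and k + 1, and inspecting the primes of A_(k+2)
    gives the remaining ones: if eta k <> eta (k + 1), then y_k is the new prime
    of A_(k+2) for the second presentation; if eta k = eta (k + 1), then
    y_(k+1) involves both x_k and x_(k+1) and is the new prime for both.
    Comparing leading coefficients, by induction along the predecessor
    functions, shows that the scalars are 1 and that the predecessor functions
    correspond to each other (identify_distinct, identify_same). Since the
    predecessor function determines everything that the definition of an
    associated function depends on, eta composed with the transposition is
    associated to the second presentation.

    Suppose eta k = eta (k + 1), and let q = y_(p(k)) and
    u = y_k y'_k - q y_(k+1). As y_k = q x_k - c, y'_k = q x_(k+1) - c' and
    y_(k+1) = y_k x_(k+1) - d, the terms with x_(k+1) cancel in u; exchanging
    the presentations, so do those with x_k, and u is in A_k. It is not zero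
    because the prime y_(k+1) divides neither y_k nor y'_k. For a in A_k,
    comparing leading coefficients in {y_j, a} = d_j y_j expresses d_j as the
    multiplier of y_(p(j)) plus sigma_j(a). As the maps sigma for x_(k+1) in the
    two presentations agree on A_k, both y_k y'_k and q y_(k+1) are multiplied
    by 2 d_q + sigma_k(a) + sigma_(k+1)(a), and then so is u.

    This last argument needs {A_k, A_k} to lie in A_k and {r, a} to be a
    derivation in a, for a in A_k. The axioms give linearity and the Leibniz
    rule in the left entry, and {z, z} = 0; they do not give antisymmetry, which
    therefore has to be deduced from the Jacobi identity. The key computation
    is symmetric_defect_kill: applying the Jacobi identity to (c, b, z) and
    iterating it once, with b, b^2 and their opposites, one finds that {-, b}
    kills {b, z} + {z, b} for every z, provided that {c, b} is not zero and that
    {r, w} depends on w as a derivation would for a few elements w built from b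
    and {c, b}. By polarization the bracket is antisymmetric
    between B and the whole algebra, for any noncommutative subalgebra B such
    that every {r, -} is a derivation on B; hence this property passes from A_i to
    A_(i+1) once A_i is noncommutative (ad_derivation_succ_noncomm).

    As long as A_i is commutative, a later variable x_n serves as a witness: the
    bracket {x_n, b} is a derivation of b in A_n by the axioms of an Ore
    extension, and if it is not zero, the Jacobi identity for (x_n, b, z) and
    (x_n, b^2, z) shows that {b, z} is a derivation in z among the z with
    {A_n, z} in A_n (ad_as_derivation). All brackets with z in A_(i+1) stay in
    A_n if all of x_0, ..., x_i are Poisson-prime in A_(i+1). Otherwise one
    x_j is not, and x_j x_i - c is; then {z, z} = 0 still shows that most z
    satisfy {A_n, z} in A_n, enough of them to apply symmetric_defect_kill to
    the elements x_i + a with a in A_i (ad_derivation_succ_comm).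

    The witness x_n is x_(k+1): its sigma is not zero because it is induced by an
    element of Lie H for which x_(k+1) has a nonzero eigenvalue, while the
    weight of y_k x_(k+1) is also that of an element of A_(k+1)
    (sigma_neq0). *)

(** * Subalgebras and polynomial rings *)

Section Subalgebras.
Variables (K : fieldType) (R : comAlgType K) (S : R -> Prop).
Local Notation B := (gen_alg S).

Lemma gen_alg0 : B 0. Proof. by rewrite -(scale0r 1); apply: gen_scalar. Qed.
Lemma gen_alg1 : B 1. Proof. by rewrite -(scale1r 1); apply: gen_scalar. Qed.

Lemma gen_algZ c a : B a -> B (c *: a).
Proof. by move=> Ba; rewrite -mulr_algl; apply/gen_mul/Ba/gen_scalar. Qed.

Lemma gen_algN a : B a -> B (- a).
Proof. by rewrite -scaleN1r; apply: gen_algZ. Qed.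

Lemma gen_algB a b : B a -> B b -> B (a - b).
Proof. by move=> Ba Bb; apply/gen_add/gen_algN. Qed.

Lemma gen_alg_unscale c a : c != 0 -> B (c *: a) -> B a.
Proof. by move=> c0 /(gen_algZ c^-1); rewrite scalerK. Qed.

Definition coefs_in (p : {poly R}) := forall n, B p`_n.

Lemma coefs_linear a b : B a -> B b -> coefs_in (a%:P * 'X + b%:P).
Proof.
move=> Ba Bb n; rewrite coefD coefMX !coefC; apply: gen_add.
  by case: n => [|[|n]] //; apply: gen_alg0.
by case: ifP => // _; apply: gen_alg0.
Qed.

Lemma coefs_sub p q : coefs_in p -> coefs_in q -> coefs_in (p - q).
Proof. by move=> Bp Bq n; rewrite coefB; apply: gen_algB. Qed.

Lemma coefs_mul p q : coefs_in p -> coefs_in q -> coefs_in (p * q).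
Proof.
move=> Bp Bq n; rewrite coefM; apply: big_ind => [||i _].
- exact: gen_alg0.
- exact: gen_add.
- exact: gen_mul.
Qed.

End Subalgebras.

Definition domain_on (R : pzRingType) (B : R -> Prop) : Prop :=
  forall a b, B a -> B b -> a * b = 0 -> a = 0 \/ b = 0.

Section PolynomialRing.
Variables (K : fieldType) (R : comAlgType K) (S S' : R -> Prop).
Variables (x : R) (C C' : R -> Prop).
Local Notation B := (gen_alg S).
Local Notation B' := (gen_alg S').
Hypothesis polyC : is_poly_ring B x C.

Lemma linear_horner (a b : R) : (a%:P * 'X + b%:P).[x] = a * x + b.
Proof. by rewrite !hornerE. Qed.

Lemma poly_ring_eq p q :
  coefs_in S p -> coefs_in S q -> p.[x] = q.[x] -> p = q.
Proof.
move=> Bp Bq pq; apply/eqP; rewrite -subr_eq0; apply/eqP.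
apply: polyC.2; last by rewrite hornerD hornerN pq subrr.
exact: coefs_sub.
Qed.

Lemma coef_linear (a b : R) n :
  (a%:P * 'X + b%:P)`_n = if n is n'.+1 then if n' is 0%N then a else 0 else b.
Proof. by rewrite coefD coefMX !coefC; case: n => [|[|n]]; rewrite ?add0r ?addr0. Qed.

Lemma linear_inj a b a' b' : B a -> B b -> B a' -> B b' ->
  a * x + b = a' * x + b' -> a = a' /\ b = b'.
Proof.
move=> Ba Bb Ba' Bb'; rewrite -!linear_horner => /poly_ring_eq E.
have {}E := E (coefs_linear Ba Bb) (coefs_linear Ba' Bb').
by split; [move: (congr1 (coefp 1) E) | move: (congr1 (coefp 0) E)];
  rewrite /coefp !coef_linear.
Qed.

(** The degree of a product is the sum of the degrees, so a multiple of a
    polynomial of degree one that has degree at most one is a multiple by a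
    constant. *)
Lemma linear_divisor a b e f g : domain_on B ->
  B a -> B b -> a <> 0 -> C e -> B f -> B g ->
  e * (a * x + b) = f * x + g -> B e /\ e * a = f.
Proof.
move=> domB Ba Bb a0 /polyC.1 [p Bp ->] Bf Bg.
rewrite -!linear_horner -hornerM => /poly_ring_eq E.
have {}E := E (coefs_mul Bp (coefs_linear Ba Bb)) (coefs_linear Bf Bg).
have coefE n : p`_n * a + p`_n.+1 * b = (f%:P * 'X + g%:P)`_n.+1.
  by rewrite -E mulrDr coefD mulrA coefMX coefMC /= coefMC.
have sz_p : (size p <= 1)%N.
  rewrite leqNgt; apply/negP => lt1p.
  have := coefE (size p).-1.
  have -> : p`_(size p).-1.+1 = 0.
    by rewrite nth_default // prednK // (ltn_trans _ lt1p).
  rewrite mul0r addr0 coef_linear; case Ep: (size p) lt1p => [|[|m]] //= _.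
  case/(domB _ _ (Bp _) Ba) => // pm0.
  have := lead_coef_eq0 p; rewrite /lead_coef Ep /= pm0 eqxx.
  by rewrite -size_poly_eq0 Ep.
have -> : p.[x] = p`_0 by rewrite (size1_polyC sz_p) hornerC coefC.
split=> //; have := coefE 0%N.
by rewrite coef_linear (nth_default 0 sz_p) mul0r addr0.
Qed.

Lemma poly_ring_domain : domain_on B -> domain_on C.
Proof.
move=> domB _ _ /polyC.1 [p Bp ->] /polyC.1 [q Bq ->] pq0.
have {}pq0 : p * q = 0.
  by apply: polyC.2; [exact: coefs_mul | rewrite hornerM].
have: lead_coef p * lead_coef q = 0.
  by rewrite mul_lead_coef pq0 coef0.
case/(domB _ _ (Bp _) (Bq _)) => /eqP; rewrite lead_coef_eq0 => /eqP ->.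
  by left; rewrite horner0.
by right; rewrite horner0.
Qed.

(** The coefficients of a polynomial in x are unique, hence do not change when
    the ring of coefficients grows from B' to B. *)
Lemma linear_descent a b : is_poly_ring B' x C' -> (forall c, B' c -> B c) ->
  B a -> B b -> C' (a * x + b) -> B' a /\ B' b.
Proof.
move=> polyC' sB'B Ba Bb /polyC'.1 [p B'p].
rewrite -linear_horner => /poly_ring_eq E.
have {}E := E (coefs_linear Ba Bb) (fun n => sB'B _ (B'p n)).
by have := (B'p 1%N, B'p 0%N); rewrite -E !coef_linear => -[].
Qed.

End PolynomialRing.


(** * Derivations and chains of polynomial extensions *)

Section Derivations.
Variables (K : fieldType) (R : comAlgType K).

Definition derivation (D : R -> R) : Prop :=
  (forall (c : K) a b, D (c *: a + b) = c *: D a + D b) /\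
  (forall a b, D (a * b) = D a * b + a * D b).

Variable D : R -> R.
Hypothesis derD : derivation D.

Lemma der_add a b : D (a + b) = D a + D b.
Proof. by have := derD.1 1 a b; rewrite !scale1r. Qed.

Lemma der_0 : D 0 = 0.
Proof. by apply: (addrI (D 0)); rewrite -der_add !addr0. Qed.

Lemma der_scale c a : D (c *: a) = c *: D a.
Proof. by have := derD.1 c a 0; rewrite der_0 !addr0. Qed.

Lemma der_opp a : D (- a) = - D a.
Proof. by rewrite -scaleN1r der_scale scaleN1r. Qed.

Lemma der_1 : D 1 = 0.
Proof.
by apply: (addrI (D 1)); rewrite addr0 -[in RHS](mulr1 1) derD.2 mulr1 mul1r.
Qed.

Lemma der_scalar c : D c%:A = 0.
Proof. by rewrite der_scale der_1 scaler0. Qed.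

Lemma der_exp a n : D (a ^+ n.+1) = a ^+ n * D a *+ n.+1.
Proof.
elim: n => [|n IHn]; first by rewrite expr1 expr0 mul1r mulr1n.
by rewrite exprS derD.2 IHn exprS [in RHS]mulrS; ring.
Qed.

Lemma der_horner (p : {poly R}) a :
  D p.[a] = (map_poly D p).[a] + p^`().[a] * D a.
Proof.
elim/poly_ind: p => [|p c IHp].
  by rewrite deriv0 map_poly0 !horner0 der_0 mul0r addr0.
have -> : map_poly D (p * 'X + c%:P) = map_poly D p * 'X + (D c)%:P.
  apply/polyP=> n; rewrite coefD coefMX coefC !coef_map_id0 ?der_0 //.
  by rewrite coefD coefMX coefC der_add; case: n => [|n] //=; rewrite der_0.
rewrite derivD derivM derivX derivC !hornerE der_add derD.2 IHp.
by ring.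
Qed.

End Derivations.

Section DerivationOperations.
Variables (K : fieldType) (R : comAlgType K) (D E : R -> R).
Hypotheses (derD : derivation D) (derE : derivation E).

Lemma derivationD : derivation (fun r => D r + E r).
Proof.
split=> [c a b|a b]; first by rewrite derD.1 derE.1 scalerDr addrACA.
by rewrite derD.2 derE.2; ring.
Qed.

Lemma derivationM f : derivation (fun r => f * D r).
Proof.
split=> [c a b|a b]; first by rewrite derD.1 mulrDr scalerAr.
by rewrite derD.2; ring.
Qed.

Lemma derivationZ c : derivation (fun r => c *: D r).
Proof.
split=> [d a b|a b]; first by rewrite derD.1 scalerDr !scalerA mulrC.
by rewrite derD.2 scalerDr scalerAl scalerAr.
Qed.

End DerivationOperations.

Section PartialAlgebras.
Variables (K : fieldType) (R : comAlgType K) (N : nat) (x : 'I_N -> R).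
Local Notation A := (partial_alg x).

Lemma partial_alg_mono m n a : (m <= n)%N -> A m a -> A n a.
Proof.
move=> mn; elim=> [c|b [j jm ->]|b c _ IHb _ IHc|b c _ IHb _ IHc].
- exact: gen_scalar.
- by apply: gen_mem; exists j => //; apply: leq_trans mn.
- exact: gen_add.
- exact: gen_mul.
Qed.

Lemma partial_alg_var (j : 'I_N) m : (j < m)%N -> A m (x j).
Proof. by move=> jm; apply: gen_mem; exists j. Qed.

Lemma partial_alg0 a : A 0 a -> exists c : K, a = c%:A.
Proof.
elim=> [c|b [j]|b b' _ [c ->] _ [c' ->]|b b' _ [c ->] _ [c' ->]] //.
- by exists c.
- by exists (c + c'); rewrite scalerDl.
- by exists (c * c'); rewrite -scalerAl mul1r scalerA.
Qed.

Lemma der_eq_gen (S : R -> Prop) D E : derivation D -> derivation E ->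
  (forall a, S a -> D a = E a) -> forall a, gen_alg S a -> D a = E a.
Proof.
move=> derD derE DE a; elim=> [c|b /DE //|b c _ Db _ Dc|b c _ Db _ Dc].
- by rewrite !der_scalar.
- by rewrite !der_add // Db Dc.
- by rewrite derD.2 derE.2 Db Dc.
Qed.

Lemma der_eq_partial m D E : derivation D -> derivation E ->
  (forall j : 'I_N, (j < m)%N -> D (x j) = E (x j)) ->
  forall a, A m a -> D a = E a.
Proof. by move=> dD dE DE; apply: der_eq_gen => // _ [j /DE jm ->]. Qed.

Lemma der_stable_partial m n D : derivation D -> (m <= n)%N ->
  (forall j : 'I_N, (j < m)%N -> A n (D (x j))) ->
  forall a, A m a -> A n (D a).
Proof.
move=> dD mn sD a; elim=> [c|b [j jm ->]|b c _ Db _ Dc|b c Bb Db Bc Dc].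
- by rewrite der_scalar //; apply: gen_alg0.
- exact: sD.
- by rewrite der_add //; apply: gen_add.
- by rewrite dD.2; apply: gen_add; apply: gen_mul => //;
    apply: partial_alg_mono mn _.
Qed.

Definition poly_chain : Prop :=
  forall i : 'I_N, is_poly_ring (A i) (x i) (A i.+1).

Hypothesis chain : poly_chain.

Lemma partial_alg_domain m : (m <= N)%N -> domain_on (A m).
Proof.
elim: m => [_ a b /partial_alg0 [c ->] /partial_alg0 [d ->]|m IHm mN].
  rewrite -scalerAl mul1r scalerA => /eqP.
  rewrite scaler_eq0 oner_eq0 orbF mulf_eq0.
  by case/orP=> /eqP ->; rewrite scale0r; [left | right].
exact: poly_ring_domain (chain (Ordinal mN)) (IHm (ltnW mN)).
Qed.

Lemma partial_alg_var_notin (i : 'I_N) : ~ A i (x i).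
Proof.
move=> Ai.
have [] := linear_inj (chain i) (gen_alg1 _) (gen_alg0 _) (gen_alg0 _) Ai _.
  by rewrite mul1r addr0 mul0r add0r.
by move/eqP; rewrite oner_eq0.
Qed.

Hypothesis full : forall a, A N a.

Lemma chain_domain (a b : R) : a * b = 0 -> a = 0 \/ b = 0.
Proof. exact: partial_alg_domain (leqnn N) _ _ (full a) (full b). Qed.

Lemma chain_mulI (a b c : R) : a <> 0 -> a * b = a * c -> b = c.
Proof.
move=> a0 /eqP; rewrite -subr_eq0 -mulrBr => /eqP /chain_domain [] // /eqP.
by rewrite subr_eq0 => /eqP.
Qed.

Lemma chain_mulf0 (a b : R) : a <> 0 -> a * b = 0 -> b = 0.
Proof. by move=> a0 /chain_domain []. Qed.

Lemma chain_mul_neq0 (a b : R) : a <> 0 -> b <> 0 -> a * b <> 0.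
Proof. by move=> a0 b0 /chain_domain []. Qed.

(** The degree of a product is the sum of the degrees. *)
Lemma partial_alg_pure m f a : (m <= N)%N ->
  A m f -> f <> 0 -> A m (f * a) -> A m a.
Proof.
move=> mN Af f0 Afa.
suff desc n : (m <= n)%N -> (n <= N)%N -> A n a -> A m a by apply: desc (full a).
elim: n => [|n IHn]; first by rewrite leqn0 => /eqP ->.
rewrite leq_eqVlt => /orP [/eqP -> //|mn] nN Aa.
apply: IHn (ltnW nN) _ => //.
pose i := Ordinal nN; have up b : A m b -> A n b by apply: partial_alg_mono.
have [] // := @linear_divisor _ _ _ (x i) _ (chain i) f 0 a (f * a) 0.
- exact/partial_alg_domain/ltnW.
- exact: up.
- exact: gen_alg0.
- exact: up.
- exact: gen_alg0.
- by rewrite !addr0; ring.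
Qed.

End PartialAlgebras.


(** * Predecessors and successors in the level sets of eta *)

Section LevelSets.
Variables (N : nat) (e : 'I_N -> int).
Implicit Types i j k : 'I_N.

Lemma eta_pred_Some k j : eta_pred e k = Some j ->
  [/\ (j < k)%N, e j = e k & forall i, (i < k)%N -> e i = e k -> (i <= j)%N].
Proof.
rewrite /eta_pred; case: pickP => // m /and3P [mk /eqP em /forallP max_m] [<-].
split=> // i ik ei; have /implyP := max_m i; apply.
by rewrite ik ei eqxx.
Qed.

Lemma eta_pred_intro k j : (j < k)%N -> e j = e k ->
  (forall i, (i < k)%N -> e i = e k -> (i <= j)%N) -> eta_pred e k = Some j.
Proof.
move=> jk ej max_j; rewrite /eta_pred.
case: pickP => [m /and3P [mk /eqP em /forallP max_m]|/(_ j)].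
  congr Some; apply/val_inj/anti_leq; rewrite max_j //=.
  by have /implyP := max_m j; apply; rewrite jk ej eqxx.
rewrite jk ej eqxx /=; case/forallP=> i; apply/implyP=> /andP [ik /eqP].
exact: max_j.
Qed.

Lemma eta_pred_None k : eta_pred e k = None ->
  forall i, (i < k)%N -> e i <> e k.
Proof.
move=> pk i ik ei.
have [j /andP [jk /eqP ej] max_j] :=
  @arg_maxnP _ i (fun j => (j < k)%N && (e j == e k)) (fun j => j : nat)
    (introT andP (conj ik (introT eqP ei))).
suff: eta_pred e k = Some j by rewrite pk.
by apply: eta_pred_intro => // l lk el; apply: max_j; rewrite lk el eqxx.
Qed.

Lemma eta_pred_lt k j : eta_pred e k = Some j -> (j < k)%N.
Proof. by case/eta_pred_Some. Qed.

Lemma eta_pred_inj i j k :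
  eta_pred e i = Some k -> eta_pred e j = Some k -> i = j.
Proof.
move=> /eta_pred_Some [ki ei max_i] /eta_pred_Some [kj ej max_j].
apply/val_inj; case: (ltngtP i j) => // [ij|ji].
  by have := max_j i ij (etrans (esym ei) ej); rewrite leqNgt ki.
by have := max_i j ji (etrans (esym ej) ei); rewrite leqNgt kj.
Qed.

Lemma succ_gtP j k :
  reflect (forall i, eta_pred e i = Some j -> (k < i)%N) (succ_gt e j k).
Proof.
apply: (iffP idP); rewrite /succ_gt /eta_succ.
  case: pickP => [m /and3P [jm /eqP em /forallP min_m] km|none _] i pi.
    have [ji ei _] := eta_pred_Some pi.
    apply: leq_trans km _; have /implyP := min_m i; apply.
    by rewrite ji ei eqxx.
  have [ji ei max_i] := eta_pred_Some pi.
  have [m /andP [jm /eqP em] min_m] :=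
    @arg_minnP _ i (fun m => (j < m)%N && (e m == e j)) (fun m => m : nat)
      (introT andP (conj ji (introT eqP (esym ei)))).
  have := none m; rewrite jm em eqxx /=; case/forallP=> l; apply/implyP=> /andP.
  by case=> jl /eqP el; apply: min_m; rewrite jl el eqxx.
move=> lt_k; case: pickP => // m /and3P [jm /eqP em /forallP min_m].
apply: lt_k; apply: eta_pred_intro => // l lm el; rewrite leqNgt; apply/negP.
move=> jl; have /implyP := min_m l; rewrite jl el em eqxx /=.
by move/(_ isT); rewrite leqNgt lm.
Qed.

Lemma succ_gt_self k : succ_gt e k k.
Proof. by apply/succ_gtP=> i /eta_pred_lt. Qed.

End LevelSets.

Lemma eq_succ_gt N (e e' : 'I_N -> int) : eta_pred e =1 eta_pred e' ->
  forall j k, succ_gt e j k = succ_gt e' j k.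
Proof.
move=> pE j k; apply/succ_gtP/succ_gtP => H i pi; apply: H.
  by rewrite pE.
by rewrite -pE.
Qed.

Lemma codom_involutive N (e : 'I_N -> int) (f : 'I_N -> 'I_N) : involutive f ->
  codom (fun j => e (f j)) =i codom e.
Proof.
move=> fK v; apply/codomP/codomP => [[j ->]|[j ->]]; first by exists (f j).
by exists (f j); rewrite fK.
Qed.

Lemma num_values_eq N (e e' : 'I_N -> int) : codom e =i codom e' ->
  num_values e = num_values e'.
Proof. by move=> ee'; apply/perm_size/perm_undup. Qed.

(** Every level set has exactly one element without successor, its last one. *)
Lemma num_values_last N (e : 'I_N -> int) (m : 'I_N) : m.+1 = N :> nat ->
  #|[pred j : 'I_N | (j <= m)%N && succ_gt e j m]| = num_values e.
Proof.
move=> mN; set I := [pred j | _].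
have le_m (j : 'I_N) : (j <= m)%N by rewrite -ltnS mN.
have lastP (j : 'I_N) : j \in I -> forall i, eta_pred e i <> Some j.
  by case/andP=> _ /succ_gtP sj i /sj; rewrite ltnNge le_m.
have I_inj : {in I &, injective e}.
  suff lt (i j : 'I_N) : i \in I -> (i < j)%N -> e i = e j -> False.
    move=> i j Ii Ij eij; apply/val_inj; case: (ltngtP i j) => // /lt.
      by case/(_ Ii eij).
    by case/(_ Ij (esym eij)).
  move=> Ii ij eij.
  have [l /andP [il /eqP el] min_l] :=
    @arg_minnP _ j (fun l => (i < l)%N && (e l == e i)) (fun l => l : nat)
      (introT andP (conj ij (introT eqP (esym eij)))).
  apply: (lastP i Ii l); apply: eta_pred_intro => // n nl en.
  rewrite leqNgt; apply/negP=> in_; have := min_l n.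
  by rewrite in_ en el eqxx => /(_ isT); rewrite leqNgt nl.
rewrite /num_values cardE -(size_map e); apply/perm_size/uniq_perm.
- rewrite map_inj_in_uniq ?enum_uniq // => i j.
  by rewrite !mem_enum; apply: I_inj.
- exact: undup_uniq.
move=> v; rewrite mem_undup; apply/mapP/codomP => [[j _ ->]|[i ->]].
  by exists j.
have [j /eqP ej max_j] :=
  @arg_maxnP _ i (fun j => e j == e i) (fun j => j : nat) (eqxx _).
exists j => //; rewrite mem_enum inE le_m; apply/succ_gtP=> l.
case/eta_pred_Some=> jl el _; have := max_j l.
by rewrite -el ej eqxx => /(_ isT) lj; move: (leq_trans jl lj); rewrite ltnn.
Qed.


(** * The sequence of homogeneous Poisson-prime elements *)

Section TorusEigenvectors.
Variables (K : fieldType) (r : nat) (R : comAlgType K).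
Variables (br : R -> R -> R) (act : {ffun 'I_r -> K} -> R -> R).
Hypothesis action : poisson_action br act.

Lemma act_sub h a b : in_torus h -> act h (a - b) = act h a - act h b.
Proof.
by move=> th; rewrite addrC -scaleN1r (act_linear action) // scaleN1r addrC.
Qed.

Lemma act_0 h : in_torus h -> act h 0 = 0.
Proof. by move=> th; rewrite -[in LHS](subrr 0) act_sub // subrr. Qed.

Lemma act_scale h (c : K) a : in_torus h -> act h (c *: a) = c *: act h a.
Proof.
by move=> th; rewrite -[c *: a]addr0 (act_linear action) // act_0 // addr0.
Qed.

Lemma homogeneous_eigen h a : in_torus h -> homogeneous act a ->
  exists c : K, act h a = c *: a.
Proof.
move=> th [-> | [_ /(_ h th)] //].
by exists 0; rewrite act_0 // scale0r.
Qed.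

End TorusEigenvectors.

Section PrimeSequence.
Variables (K : fieldType) (r N : nat) (R : comAlgType K).
Variables (br : R -> R -> R) (act : {ffun 'I_r -> K} -> R -> R).
Variables (x : 'I_N -> R) (sigma delta : 'I_N -> R -> R).
Variables (eta : 'I_N -> int) (y : 'I_N -> R).
Local Notation A := (partial_alg x).
Hypothesis pres : is_pcgl br act x sigma delta.
Hypothesis assoc : associated br act x eta y.

Lemma pcgl_chain : poly_chain x.
Proof. by move=> i; case: (pcgl_ore pres i). Qed.

Let chain := pcgl_chain.
Let full := pcgl_full pres.

Lemma y_prime (j k : 'I_N) : (j <= k)%N -> succ_gt eta j k ->
  poisson_prime br (A k.+1) (y j).
Proof.
move=> jk sjk; case: assoc => c [_ _ _ /(_ k)] [+ _ _].
by case/(_ j) => //; rewrite /= jk.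
Qed.

Lemma y_homogeneous j : homogeneous act (y j).
Proof. by case: assoc => c []. Qed.

Lemma y_neq0 j : y j <> 0.
Proof. exact: prime_neq0 (y_prime (leqnn j) (succ_gt_self eta j)). Qed.

Lemma y_mem (j : 'I_N) : A j.+1 (y j).
Proof. by have [_ []] := y_prime (leqnn j) (succ_gt_self eta j). Qed.

Lemma y_pred_mem (j : 'I_N) : A j (y_pred eta y j).
Proof.
rewrite /y_pred; case pj: (eta_pred eta j) => [i|]; last exact: gen_alg1.
exact: partial_alg_mono (eta_pred_lt pj) (y_mem i).
Qed.

Lemma y_pred_neq0 j : y_pred eta y j <> 0.
Proof.
rewrite /y_pred; case: eta_pred => [i|]; first exact: y_neq0.
by move/eqP; rewrite oner_eq0.
Qed.

Lemma y_pred_homogeneous j : homogeneous act (y_pred eta y j).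
Proof.
rewrite /y_pred; case: eta_pred => [i|]; first exact: y_homogeneous.
right; split=> [|h th]; first by move/eqP; rewrite oner_eq0.
by exists 1; rewrite (act_mul1 (pcgl_action pres)) ?scale1r.
Qed.

Definition y_tail j := y_pred eta y j * x j - y j.

Lemma y_rec j : y j = y_pred eta y j * x j + - y_tail j.
Proof. by rewrite /y_tail subKr. Qed.

Lemma y_tail_spec (j : 'I_N) : A j (y_tail j) /\ homogeneous act (y_tail j).
Proof.
rewrite /y_tail /y_pred; case: assoc => c [hc -> _ _].
case pj: (eta_pred eta j) => [i|]; last first.
  by rewrite mul1r subrr; split; [apply: gen_alg0 | left].
rewrite opprB addrC subrK; have [] := hc j; first by rewrite pj.
by move=> hcj Acj; split.
Qed.

Lemma y_tail_mem (j : 'I_N) : A j (y_tail j). Proof. by case: (y_tail_spec j). Qed.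

Lemma y_tail_None j : eta_pred eta j = None -> y_tail j = 0.
Proof.
move=> pj; rewrite /y_tail /y_pred; case: assoc => c [_ -> _ _].
by rewrite pj mul1r subrr.
Qed.

Lemma y_tailN_mem (j : 'I_N) : A j (- y_tail j).
Proof. exact/gen_algN/y_tail_mem. Qed.

Lemma y_notin (j : 'I_N) : ~ A j (y j).
Proof.
move=> Aj; suff: y_pred eta y j = 0 by apply: y_pred_neq0.
have [] // := linear_inj (chain j) (y_pred_mem j) (y_tailN_mem j)
  (gen_alg0 _) Aj _.
by rewrite -y_rec mul0r add0r.
Qed.

Lemma y_scale_inj (a : K) i j : a != 0 -> y j = a *: y i -> i = j.
Proof.
move=> a0 yj; apply/val_inj; case: (ltngtP i j) => // [ij|ji].
  case: (@y_notin j); rewrite yj; apply: gen_algZ.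
  exact: partial_alg_mono ij (y_mem i).
case: (@y_notin i); apply: (gen_alg_unscale a0); rewrite -yj.
exact: partial_alg_mono ji (y_mem j).
Qed.

Lemma y_option_inj (a : K) o o' : a != 0 -> a *: oapp y 1 o = oapp y 1 o' ->
  o = o' /\ a = 1.
Proof.
move=> a0; have notK (b : K) j : b%:A <> y j.
  by move=> yj; apply: (@y_notin j); rewrite -yj; apply: gen_scalar.
have a1 (z : R) : z <> 0 -> a *: z = z -> a = 1.
  move=> z0 /eqP; rewrite -subr_eq0 -[X in _ - X]scale1r -scalerBl scaler_eq0.
  by rewrite subr_eq0 => /orP [/eqP | /eqP /z0].
case: o o' => [i|] [j|] //=.
- move=> yij; have ij := y_scale_inj a0 (esym yij); rewrite -ij in yij *.
  by split=> //; apply: a1 yij; apply: y_neq0.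
- move=> yi; case: (@notK a^-1 i).
  by rewrite -yi scalerA mulVf // scale1r.
- by move/notK.
by move/a1=> ->; last by move/eqP; rewrite oner_eq0.
Qed.

(** The homogeneous Poisson-primes of the first j + 1 variables other than y_j
    are among y_0, ..., y_(j-1), which do not involve the last variable. *)
Lemma new_prime (j : 'I_N) c : homogeneous act c -> poisson_prime br (A j.+1) c ->
  ~ A j c -> exists2 a : K, a != 0 & c = a *: y j.
Proof.
move=> hc pc ncA; case: assoc => d [_ _ _ /(_ j)] [_ /(_ c hc pc) + _].
case=> i /andP [ij _] [a a0 ca]; exists a => //; rewrite ca.
congr (_ *: y _); apply/val_inj/eqP; rewrite eqn_leq ij /= leqNgt.
apply/negP=> lt_ij; apply: ncA; rewrite ca; apply: gen_algZ.
exact: partial_alg_mono lt_ij (y_mem i).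
Qed.

Lemma y_not_divisor (j : 'I_N) b z : A j z -> z <> 0 -> A j.+1 b -> z <> b * y j.
Proof.
move=> Az z0 Ab zb; apply: (z0).
have dj := partial_alg_domain chain (ltnW (ltn_ord j)).
have [] // := @linear_divisor _ _ _ _ _ (chain j) (y_pred eta y j)
  (- y_tail j) b 0 z dj.
- exact: y_pred_mem.
- exact: y_tailN_mem.
- exact: y_pred_neq0.
- exact: gen_alg0.
- by rewrite -y_rec mul0r add0r.
move=> _ by0; rewrite zb mulrC.
have [-> | /y_pred_neq0 //] := chain_domain chain full by0.
by rewrite mulr0.
Qed.

(** The term of degree one in x_j determines the eigenvalues of y_j. *)
Lemma y_eigenvalue j h (a b : K) : in_torus h ->
  act h (y_pred eta y j) = a *: y_pred eta y j -> act h (x j) = b *: x j ->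
  act h (y j) = (a * b) *: y j /\ act h (y_tail j) = (a * b) *: y_tail j.
Proof.
move=> th hp hx; have action := pcgl_action pres.
have [d hd] := homogeneous_eigen action th (y_tail_spec j).2.
have [w hw] := homogeneous_eigen action th (y_homogeneous j).
have: (a * b) *: y_pred eta y j * x j + - (d *: y_tail j) =
    w *: y_pred eta y j * x j + - (w *: y_tail j).
  rewrite -(scalerAl w) -scalerBr -y_rec -hw [in RHS](y_rec j).
  rewrite (act_sub action) // (act_mul action) // hp hx hd.
  by rewrite -!scalerAl -!scalerAr scalerA.
case/(linear_inj (chain j)).
- exact/gen_algZ/y_pred_mem.
- exact/gen_algN/gen_algZ/y_tail_mem.
- exact/gen_algZ/y_pred_mem.
- exact/gen_algN/gen_algZ/y_tail_mem.
move=> abw /oppr_inj dw.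
have wE : w = a * b.
  move/eqP: abw; rewrite -subr_eq0 -scalerBl scaler_eq0.
  by rewrite subr_eq0 => /orP [/eqP -> // | /eqP /y_pred_neq0].
by rewrite -wE hw hd dw.
Qed.

End PrimeSequence.


(** * Weights of torus eigenvectors *)

Section Characters.
Variables (K : fieldType) (r : nat).
Implicit Types (g h : {ffun 'I_r -> K}) (u v : {ffun 'I_r -> int}).

Definition torus_mul g h : {ffun 'I_r -> K} := [ffun i => g i * h i].

Lemma in_torus_mul g h : in_torus g -> in_torus h -> in_torus (torus_mul g h).
Proof. by move=> tg th i; rewrite ffunE mulf_neq0. Qed.

Lemma torus_char_mul u g h :
  torus_char u (torus_mul g h) = torus_char u g * torus_char u h.
Proof.
rewrite /torus_char -big_split /=; apply: eq_bigr => i _.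
by rewrite ffunE expfzMl.
Qed.

Lemma torus_char_add u v h : in_torus h ->
  torus_char [ffun i => u i + v i] h = torus_char u h * torus_char v h.
Proof.
move=> th; rewrite /torus_char -big_split /=; apply: eq_bigr => i _.
by rewrite ffunE expfzDr.
Qed.

(** Dedekind's independence of characters: comparing the values at h and at
    g h removes from a linear combination a character that differs from chi
    at g. *)
Lemma multiplicative_regular (chi : {ffun 'I_r -> K} -> K) :
  (forall g h, in_torus g -> in_torus h ->
     chi (torus_mul g h) = chi g * chi h) ->
  (exists2 h, in_torus h & chi h != 0) -> torus_regular chi ->
  exists u, forall h, in_torus h -> chi h = torus_char u h.
Proof.
move=> chiM [h0 th0 chi_h0] [l]; have [n] := ubnP (size l).
elim: n l => // n IHn [|[a u] l] szl chiE.
  by move: chi_h0; rewrite chiE // big_nil eqxx.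
have [chi_u | /not_all_ex_not [g]] :=
  classic (forall h, in_torus h -> chi h = torus_char u h); first by exists u.
move=> chi_u; have [tg /eqP chi_g] := imply_to_and _ _ chi_u.
move: (chi_g); rewrite -subr_eq0 => dg0.
pose d := chi g - torus_char u g.
pose f (t : K * {ffun 'I_r -> int}) :=
  (t.1 * (torus_char t.2 g - torus_char u g) / d, t.2).
apply: (IHn (map f l)) => [|h th]; first by rewrite size_map.
apply: (mulfI dg0); rewrite mulrBl -chiM // (chiE _ (in_torus_mul tg th)).
rewrite chiE // !big_cons /= torus_char_mul mulrDr.
rewrite opprD addrACA [X in X + _](_ : _ = 0) ?add0r; last by ring.
rewrite big_map !mulr_sumr -sumrB; apply: eq_bigr => t _ /=.
by rewrite torus_char_mul /d; field; rewrite dg0.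
Qed.

Lemma torus_regular_sum n (c : 'I_n -> K) (F : 'I_n -> {ffun 'I_r -> K} -> K) :
  (forall j, torus_regular (F j)) ->
  torus_regular (fun h => \sum_j c j * F j h).
Proof.
move=> regF; elim: (index_enum _) => [|j s [l IHs]].
  by exists [::] => h _; rewrite !big_nil.
have [lj Fj] := regF j.
exists ([seq (c j * t.1, t.2) | t <- lj] ++ l) => h th.
rewrite big_cons big_cat big_map /= -IHs // Fj // mulr_sumr; congr (_ + _).
by apply: eq_bigr => t _; rewrite mulrA.
Qed.

End Characters.

Section Weights.
Variables (K : fieldType) (r : nat) (R : comAlgType K).
Variables (br : R -> R -> R) (act : {ffun 'I_r -> K} -> R -> R).
Hypotheses (action : poisson_action br act) (rational : rational_action act).

Lemma act_sum n (c : 'I_n -> K) (v : 'I_n -> R) h : in_torus h ->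
  act h (\sum_i c i *: v i) = \sum_i c i *: act h (v i).
Proof.
move=> th; elim: (index_enum _) => [|j s IHs].
  by rewrite !big_nil (act_0 action).
by rewrite !big_cons (act_linear action) // IHs.
Qed.

(** The eigenvalue of an eigenvector is a matrix coefficient of the action up
    to a scalar, hence a multiplicative regular function. *)
Lemma eigenvector_weight a : eigenvector act a -> exists u, has_weight act u a.
Proof.
case=> a0 eig; have [n [v [f [free_v [c aE] regf fE]]]] := rational a.
have [i ci0] : exists i, c i != 0.
  apply/existsP; apply: contra_notT a0 => /existsPn c0.
  by rewrite aE big1 // => i _; rewrite (eqP (negPn (c0 i))) scale0r.
pose chi h := \sum_j (c i)^-1 * c j * f i j h.
have chiE h : in_torus h -> act h a = chi h *: a.
  move=> th; have [b ab] := eig h th; rewrite ab; congr (_ *: _).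
  have: \sum_l (\sum_j c j * f l j h - b * c l) *: v l = 0.
    under eq_bigr do rewrite scalerBl.
    rewrite sumrB; apply/eqP; rewrite subr_eq0; apply/eqP.
    under [RHS]eq_bigr do rewrite -scalerA.
    rewrite -scaler_sumr -aE -ab [in RHS]aE act_sum //.
    under [RHS]eq_bigr do rewrite fE // scaler_sumr.
    rewrite exchange_big; apply: eq_bigr => l _; rewrite scaler_suml.
    by apply: eq_bigr => j _; rewrite scalerA.
  move/free_v => /(_ i) /eqP; rewrite subr_eq0 => /eqP fb.
  rewrite /chi; under eq_bigr do rewrite -mulrA.
  by rewrite -mulr_sumr fb mulrCA mulVf ?mulr1.
have chi_inj (b d : K) : b *: a = d *: a -> b = d.
  move/eqP; rewrite -subr_eq0 -scalerBl scaler_eq0 subr_eq0.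
  by case/orP=> /eqP.
have [|||u chi_u] := @multiplicative_regular _ _ chi.
- move=> g h tg th; apply: chi_inj.
  rewrite -chiE; last exact: in_torus_mul.
  rewrite (act_comp action) // (chiE h) // (act_scale action) // chiE //.
  by rewrite scalerA mulrC.
- exists [ffun=> 1]; first by move=> j; rewrite ffunE oner_eq0.
  apply/eqP=> chi0; apply: a0; rewrite -[a](act_one action) chiE ?chi0 ?scale0r //.
  by move=> j; rewrite ffunE oner_eq0.
- exact: torus_regular_sum.
by exists u => h th; rewrite chiE // chi_u.
Qed.

Lemma homogeneous_weight a : homogeneous act a -> a <> 0 ->
  exists u, has_weight act u a.
Proof. by case=> [-> //|/eigenvector_weight]. Qed.

End Weights.

Section NontrivialSigma.
Variables (K : fieldType) (r N : nat) (R : comAlgType K).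
Variables (br : R -> R -> R) (act : {ffun 'I_r -> K} -> R -> R).
Variables (x : 'I_N -> R) (sigma delta : 'I_N -> R -> R).
Variables (eta : 'I_N -> int) (y : 'I_N -> R).
Local Notation A := (partial_alg x).
Hypothesis pres : is_pcgl br act x sigma delta.
Hypothesis assoc : associated br act x eta y.

(** If sigma_m vanished, the element of Lie H inducing it would kill all the
    weights of the first m variables but not that of x_m; then no element of
    A_m other than 0 would have the weight of y_(p(m)) x_m, so that y_m would
    be the product y_(p(m)) x_m, which is not prime. *)
Lemma sigma_neq0 (m : 'I_N) : eta_pred eta m <> None ->
  exists2 b, A m b & sigma m b <> 0.
Proof.
move=> pm; apply: NNPP => sigma0.
have {}sigma0 b : A m b -> sigma m b = 0.
  by move=> Ab; apply: NNPP => sb; apply: sigma0; exists b.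
have [action rational] := (pcgl_action pres, pcgl_rational pres).
have [chain full] := (pcgl_chain pres, pcgl_full pres).
have [xi [D [[linD wtD] sigmaE [lambda lam0 Dx]]]] := pcgl_lie pres m.
have q0 := @y_pred_neq0 _ _ _ _ _ _ _ _ _ assoc m.
have Aq := y_pred_mem assoc m.
have [v wv] := homogeneous_weight action rational
  (y_pred_homogeneous pres assoc m) q0.
have [u wu] := eigenvector_weight action rational (pcgl_eigen pres m).
have x0 : x m <> 0 by case: (pcgl_eigen pres m).
have scale_inj (b d : K) (a : R) : a <> 0 -> b *: a = d *: a -> b = d.
  move=> a0 /eqP; rewrite -subr_eq0 -scalerBl scaler_eq0 subr_eq0.
  by case/orP=> /eqP.
pose pair w := \sum_(i < r) (w i)%:~R * xi i.
have vxi : pair v = 0.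
  apply: (scale_inj _ _ _ q0); rewrite scale0r -(wtD _ _ wv).
  by rewrite -sigmaE ?sigma0.
have uxi : pair u = lambda.
  by apply: (scale_inj _ _ _ x0); rewrite -(wtD _ _ wu).
have tail0 : y_tail x eta y m = 0.
  have At := y_tail_mem assoc m.
  have: D (y_tail x eta y m) = 0 by rewrite -sigmaE ?sigma0.
  rewrite (wtD [ffun i => v i + u i]) => [/eqP|h th].
    rewrite scaler_eq0 => /orP [|/eqP //].
    rewrite (_ : \sum_(i < r) _ = pair v + pair u).
      by rewrite vxi uxi add0r (negPf lam0).
    rewrite -big_split; apply: eq_bigr => i _.
    by rewrite ffunE rmorphD mulrDl.
  have [_ ->] := y_eigenvalue pres assoc th (wv h th) (wu h th).
  by rewrite torus_char_add.
have yE : y m = y_pred eta y m * x m.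
  by rewrite (y_rec x eta y m) tail0 subr0.
have y_pr := y_prime assoc (leqnn m) (succ_gt_self eta m).
have [|[b Ab qE]|[b Ab xE]] :=
  prime_domain y_pr (partial_alg_mono (leqnSn m) Aq)
    (partial_alg_var x (ltnSn m)).
- by exists 1; rewrite ?mul1r ?yE //; apply: gen_alg1.
- exact: (y_not_divisor pres assoc Aq q0 Ab).
have [Amb bq1] := linear_divisor (chain m)
  (partial_alg_domain chain (ltnW (ltn_ord m))) Aq (gen_alg0 _) q0 Ab
  (gen_alg1 _) (gen_alg0 _)
  (etrans (congr1 _ (addr0 _))
     (etrans (congr1 _ (esym yE))
        (etrans (esym xE) (esym (etrans (addr0 _) (mul1r _)))))).
move: q0 bq1; rewrite /y_pred; case pmE: (eta_pred eta m) => [i|] // yi0 bq1.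
have yi_pr := y_prime assoc (leqnn i) (succ_gt_self eta i).
apply: (prime_proper yi_pr); exists b => //.
apply: (partial_alg_pure chain full (ltn_ord i) (y_mem assoc i) yi0).
by rewrite mulrC bq1; apply: gen_alg1.
Qed.

End NontrivialSigma.


(** * Brackets that are linear on the left *)

Section LeftPoisson.
Variables (K : fieldType) (charK0 : has_pchar0 K) (R : comAlgType K).
Variable br : R -> R -> R.
Hypothesis poisson : is_poisson br.

Lemma mulrSn_eq0 (a : R) n : a *+ n.+1 = 0 -> a = 0.
Proof.
rewrite -scaler_nat => /eqP; rewrite scaler_eq0 => /orP [|/eqP //].
by rewrite ((pcharf0P K).1 charK0).
Qed.

Lemma br_der z : derivation (br^~ z).
Proof.
split=> [c a b|a b]; first exact: br_linear.
exact: br_leibniz.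
Qed.

Lemma brDl a b z : br (a + b) z = br a z + br b z.
Proof. exact: der_add (br_der z) a b. Qed.

Lemma brNl a z : br (- a) z = - br a z.
Proof. exact: der_opp (br_der z) a. Qed.

Lemma brZl c a z : br (c *: a) z = c *: br a z.
Proof. exact: der_scale (br_der z) c a. Qed.

Lemma br0l z : br 0 z = 0.
Proof. exact: der_0 (br_der z). Qed.

Lemma br1l z : br 1 z = 0.
Proof. exact: der_1 (br_der z). Qed.

Lemma brMnl a n z : br (a *+ n) z = br a z *+ n.
Proof. by elim: n => [|n IHn]; rewrite ?br0l // !mulrS brDl IHn. Qed.

Lemma brMl a b z : br (a * b) z = br a z * b + a * br b z.
Proof. exact: (br_der z).2. Qed.

Lemma brXl_self b n : br (b ^+ n) b = 0.
Proof.
case: n => [|n]; first by rewrite expr0 br1l.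
by rewrite (der_exp (br_der b)) (br_alt poisson) mulr0 mul0rn.
Qed.

(** The Jacobi identity with a = 0. *)
Lemma br0r z : br z 0 = 0.
Proof.
have J b : br b (br z 0) + br z 0 = 0.
  by have := br_jacobi poisson 0 b z; rewrite !br0l add0r.
by have := J 0; rewrite br0l add0r.
Qed.

(** Write p = {b, z} and q = {z, b}; then {b, p} = - {b, q}, so that the Jacobi
    identities for (c, b, p) and (c, - b, q) both compute {c, {b, p}}, and those
    for (c, b^2, p) and (c, - b^2, q) both compute {c, 2 b {b, p}}. The
    hypotheses evaluate the differences of the latter and of 2 b times the
    former, as 2 g {p, b} and - 2 g {q, b} up to a common sign. *)
Lemma symmetric_defect_kill b c g z :
  br c b = g -> br c (- b) = - g ->
  br c (b * b) = (b * g) *+ 2 -> br c (- (b * b)) = - ((b * g) *+ 2) ->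
  (forall r, br r ((b * g) *+ 2) = (b * br r g) *+ 2 + (g * br r b) *+ 2) ->
  (forall r, br r (- ((b * g) *+ 2)) =
     (b * br r (- g)) *+ 2 - (g * br r b) *+ 2) ->
  g * br (br b z + br z b) b = 0.
Proof.
move=> gE gN gS gSN gD gDN; set p := br b z; set q := br z b.
pose r := br b p; have qE : br b q = - r.
  have := br_jacobi poisson b b z; rewrite (br_alt poisson) br0r addr0.
  by move/eqP; rewrite addrC addr_eq0 => /eqP.
have J1 : br c r + br b (br p c) + br p g = 0.
  by have := br_jacobi poisson c b p; rewrite gE.
have J2 : br c ((b * r) *+ 2) + (b * br b (br p c)) *+ 2
    + ((b * br p g) *+ 2 + (g * br p b) *+ 2) = 0.
  rewrite -gD -gS -(br_jacobi poisson c (b * b) p) !brMl -/r.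
  by congr (br c _ + _ + _); ring.
have J3 : br c r - br b (br q c) + br q (- g) = 0.
  rewrite -gN -(br_jacobi poisson c (- b) q) !brNl qE opprK.
  by [].
have J4 : br c ((b * r) *+ 2) - (b * br b (br q c)) *+ 2
    + ((b * br q (- g)) *+ 2 - (g * br q b) *+ 2) = 0.
  rewrite -gDN -gSN -(br_jacobi poisson c (- (b * b)) q) !brNl !brMl qE.
  by congr (br c _ + _ + _); ring.
apply: (@mulrSn_eq0 _ 1); rewrite brDl.
have -> : (g * (br p b + br q b)) *+ 2 =
  (br c ((b * r) *+ 2) + (b * br b (br p c)) *+ 2
    + ((b * br p g) *+ 2 + (g * br p b) *+ 2))
  - (br c ((b * r) *+ 2) - (b * br b (br q c)) *+ 2
    + ((b * br q (- g)) *+ 2 - (g * br q b) *+ 2))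
  - (b *+ 2) * ((br c r + br b (br p c) + br p g)
    - (br c r - br b (br q c) + br q (- g))) by ring.
by rewrite J1 J2 J3 J4; ring.
Qed.

(** For a Poisson bracket this holds on the whole algebra; below it is
    established for larger and larger B. *)
Record ad_derivation_on (B : R -> Prop) : Prop := AdDerivation {
  ad_linear : forall (c : K) a b r, B a -> B b ->
    br r (c *: a + b) = c *: br r a + br r b;
  ad_mul : forall a b r, B a -> B b -> br r (a * b) = a * br r b + b * br r a }.

Section AdDerivation.
Variable S : R -> Prop.
Local Notation B := (gen_alg S).
Hypothesis adB : ad_derivation_on B.

Lemma ad_add a b r : B a -> B b -> br r (a + b) = br r a + br r b.
Proof. by move=> Ba Bb; rewrite -{1}(scale1r a) (ad_linear adB) // scale1r. Qed.

Lemma ad_scale c a r : B a -> br r (c *: a) = c *: br r a.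
Proof.
move=> Ba; rewrite -{1}[c *: a]addr0 (ad_linear adB) //; last exact: gen_alg0.
by rewrite br0r addr0.
Qed.

Lemma ad_opp a r : B a -> br r (- a) = - br r a.
Proof. by move=> Ba; rewrite -scaleN1r ad_scale // scaleN1r. Qed.

Lemma ad_natmul a n r : B a -> br r (a *+ n) = br r a *+ n.
Proof. by move=> Ba; rewrite -!scaler_nat ad_scale. Qed.

Lemma ad_scalar c r : br r c%:A = 0.
Proof.
rewrite ad_scale; last exact: gen_alg1.
suff -> : br r 1 = 0 by rewrite scaler0.
apply: (addrI (br r 1)); have B1 := gen_alg1 S.
by rewrite addr0 -[in RHS](mul1r 1) (ad_mul adB) // mul1r.
Qed.

Lemma ad_antisym a b : B a -> B b -> br a b = - br b a.
Proof.
move=> Ba Bb; apply/eqP; rewrite -addr_eq0; apply/eqP.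
rewrite -(br_alt poisson (a + b)) ad_add // !brDl !(br_alt poisson).
by rewrite add0r addr0 addrC.
Qed.

(** The defect w |-> {w, z} + {z, w} satisfies the Leibniz rule, so the
    vanishing of {-, e + a} on the defect of e + a, for a among 0, b, 2 b, b^2,
    2 b^2, forces {b, e} times the defect of b to vanish. *)
Lemma symmetric_defect_polarize e b z : B b ->
  (forall a r, B a -> br r (e + a) = br r e + br r a) ->
  (forall a, B a -> br b a = 0 ->
     br (br (e + a) z + br z (e + a)) (e + a) = 0) ->
  br b e * (br b z + br z b) = 0.
Proof.
move=> Bb adD kill; pose nu w := br w z + br z w.
have B2 a : B a -> B (a *+ 2) by move=> Ba; rewrite mulr2n; apply: gen_add.
have nuD a : B a -> nu (e + a) = nu e + nu a.
  by move=> Ba; rewrite /nu brDl adD //; ring.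
have nu2 a : B a -> nu (a *+ 2) = nu a *+ 2.
  by move=> Ba; rewrite /nu brMnl ad_natmul // mulrnDl.
have {}kill a : B a -> br b a = 0 ->
    br (nu e) e + br (nu e) a + (br (nu a) e + br (nu a) a) = 0.
  by move=> Ba ba; rewrite -(kill a Ba ba) -/(nu (e + a)) nuD // adD // !brDl; ring.
have kill_e : br (nu e) e = 0.
  have := kill 0 (gen_alg0 _) (br0r _).
  have -> : nu 0 = 0 by rewrite /nu br0l br0r addr0.
  by rewrite br0r !br0l !addr0.
have cross a : B a -> br b a = 0 -> br (nu e) a + br (nu a) e = 0.
  move=> Ba ba; have k1 := kill a Ba ba.
  have k2 : br (nu e) e + (br (nu e) a) *+ 2
      + ((br (nu a) e) *+ 2 + (br (nu a) a) *+ 2 *+ 2) = 0.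
    rewrite -(kill (a *+ 2) (B2 a Ba)); last by rewrite ad_natmul ?ba ?mul0rn.
    by rewrite nu2 // !ad_natmul // !brMnl.
  apply: (@mulrSn_eq0 _ 1).
  rewrite kill_e add0r in k1; rewrite kill_e add0r in k2.
  have -> : (br (nu e) a + br (nu a) e) *+ 2 =
    (br (nu e) a + (br (nu a) e + br (nu a) a)) *+ 4
    - (br (nu e) a *+ 2 + (br (nu a) e *+ 2 + br (nu a) a *+ 2 *+ 2)) by ring.
  by rewrite k1 k2 mul0rn subr0.
have bb : br b (b * b) = 0 by rewrite (ad_mul adB) // (br_alt poisson); ring.
have := cross (b * b) (gen_mul Bb Bb) bb.
have c1 := cross b Bb (br_alt poisson b).
have -> : nu (b * b) = (b * nu b) *+ 2.
  by rewrite /nu brMl (ad_mul adB) //; ring.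
rewrite brMnl brMl (ad_mul adB) // => c2.
apply: (@mulrSn_eq0 _ 1); rewrite -c2 -/(nu b).
have -> : br b e * nu b *+ 2 = br b e * nu b *+ 2 +
  (b *+ 2) * (br (nu e) b + br (nu b) e) by rewrite c1; ring.
by ring.
Qed.

(** Over a noncommutative B, the bracket is antisymmetric between B and the
    whole algebra, whatever {-, z} is for z outside B. *)
Lemma ad_antisym_total a b z :
  (forall f g : R, f * g = 0 -> f = 0 \/ g = 0) ->
  (forall f g, B f -> B g -> B (br f g)) ->
  B a -> B b -> br b a <> 0 ->
  forall w, B w -> br w z + br z w = 0.
Proof.
move=> dom Bbr Ba Bb ba0.
suff key w v : B w -> B v -> br w v <> 0 -> br w z + br z w = 0.
  move=> w Bw; have [wa0|/eqP wa0] := eqVneq (br w a) 0; last exact: key wa0.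
  have := key (w + b) a (gen_add Bw Bb) Ba.
  rewrite brDl wa0 add0r brDl ad_add // => /(_ ba0).
  by rewrite addrACA (key b a Bb Ba ba0) addr0.
move=> Bw Bv wv0.
have [|c Bc wc|//|//] := dom _ _ (symmetric_defect_polarize (e := v) (z := z) Bw _ _).
  by move=> c r Bc; rewrite ad_add.
pose u := v + c; have Bu : B u by apply: gen_add.
have uE : br w u = br w v by rewrite /u ad_add // wc addr0.
have Bg : B (br w u) by apply: Bbr.
have g0 : br w u <> 0 by rewrite uE.
rewrite -/u; have [] // := dom _ _
  (symmetric_defect_kill (b := u) (c := w) z erefl _ _ _ _ _).
- by rewrite ad_opp.
- by rewrite (ad_mul adB) //; ring.
- rewrite ad_opp; last exact: gen_mul.
  by rewrite (ad_mul adB) //; ring.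
- move=> r; rewrite ad_natmul; last exact: gen_mul.
  by rewrite (ad_mul adB) //; ring.
move=> r; have Bug : B (u * br w u *+ 2).
  by rewrite mulr2n; apply: gen_add; apply: gen_mul.
rewrite ad_opp // ad_natmul; last exact: gen_mul.
by rewrite (ad_mul adB) // (ad_opp _ Bg); ring.
Qed.

End AdDerivation.

End LeftPoisson.


(** * Recovering antisymmetry from the presentation *)

Lemma map_horner (R : comNzRingType) (f : R -> R) (p : {poly R}) a : f 0 = 0 ->
  (map_poly f p).[a] = \sum_(n < size p) f p`_n * a ^+ n.
Proof.
move=> f0; rewrite (@horner_coef_wide _ (size p)) ?size_poly //.
by apply: eq_bigr => n _; rewrite coef_map_id0.
Qed.

Section Presentation.
Variables (K : fieldType) (charK0 : has_pchar0 K) (r N : nat).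
Variables (R : comAlgType K) (br : R -> R -> R).
Variables (act : {ffun 'I_r -> K} -> R -> R).
Variables (x : 'I_N -> R) (sigma delta : 'I_N -> R -> R).
Hypothesis pres : is_pcgl br act x sigma delta.
Local Notation A := (partial_alg x).
Let poisson := pcgl_poisson pres.
Let chain := pcgl_chain pres.
Let full := pcgl_full pres.
Let der z : derivation (br^~ z) := br_der poisson z.

(** The maps sigma_i and delta_i, hence the bracket with x_i, are known to be
    derivations on A_i only. *)
Definition derivation_within (B : R -> Prop) (D : R -> R) : Prop :=
  (forall (c : K) a b, B a -> B b -> D (c *: a + b) = c *: D a + D b) /\
  (forall a b, B a -> B b -> D (a * b) = D a * b + a * D b).

Lemma derivation_within_weaken (B : R -> Prop) D :
  derivation D -> derivation_within B D.
Proof. by case=> D1 D2; split=> *; [apply: D1 | apply: D2]. Qed.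

Lemma var_bracket_derivation (i : 'I_N) : derivation_within (A i) (br (x i)).
Proof.
have [_ [[_ sl sm] _] [[_ dl dm] _] xE] := pcgl_ore pres i.
split=> [c a b Aa Ab|a b Aa Ab]; last first.
  by rewrite !xE ?sm ?dm //; [ring | apply: gen_mul].
rewrite !xE ?sl ?dl //; last exact/gen_add/Ab/gen_algZ.
by rewrite mulrDl scalerDr -scalerAl addrACA.
Qed.

Lemma var_bracket_mem (i : 'I_N) b : A i b -> A i.+1 (br (x i) b).
Proof.
move=> Ab; have [_ [[sA _ _] _] [[dA _ _] _] xE] := pcgl_ore pres i.
have up a : A i a -> A i.+1 a by apply: partial_alg_mono.
rewrite xE //; apply: gen_add; last exact/up/dA.
by apply: gen_mul; [apply/up/sA | apply: partial_alg_var].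
Qed.

(** Brackets of variables with elements of lower algebras are additive in both
    entries by the axioms of an Ore extension, so only the brackets of the
    first m variables with elements of A_m may fail to be. *)
Lemma ad_derivation_from_vars m :
  (forall j : 'I_N, (j < m)%N -> derivation_within (A m) (br (x j))) ->
  ad_derivation_on br (A m).
Proof.
move=> vars; have {}vars j : derivation_within (A m) (br (x j)).
  case: (ltnP j m) => [/vars //|mj].
  have [bl bm] := var_bracket_derivation j.
  by split=> *; [apply: bl | apply: bm]; apply: partial_alg_mono mj _.
split=> [c a b s Aa Ab|a b s Aa Ab].
  have dR := derivationD (derivationZ (der a) c) (der b).
  apply: (der_eq_partial (der _) dR (m := N)) (full s) => j _.
  exact: (vars j).1.
have dR := derivationD (derivationM (der b) a) (derivationM (der a) b).
apply: (der_eq_partial (der _) dR (m := N)) (full s) => j _.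
by rewrite (vars j).2 //; ring.
Qed.

Lemma ad_derivation0 : ad_derivation_on br (A 0).
Proof. by apply: ad_derivation_from_vars. Qed.

Lemma ad_stable m z a : ad_derivation_on br (A m) -> A m z -> A m a ->
  A m (br a z).
Proof.
move=> adA Az; apply: (der_stable_partial (der z) (leqnn m)) => j jm.
elim: Az => [c|_ [i im ->]|b c Ab sb Ac sc|b c Ab sb Ac sc].
- by rewrite (ad_scalar poisson adA); apply: gen_alg0.
- case: (ltngtP i j) => [ij|ji|/val_inj ->].
  + apply: partial_alg_mono jm _; apply: var_bracket_mem.
    exact: partial_alg_var.
  + rewrite (ad_antisym poisson adA) ?partial_alg_var //; try exact: partial_alg_var.
    apply: gen_algN; apply: partial_alg_mono im _; apply: var_bracket_mem.
    exact: partial_alg_var.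
  + by rewrite (br_alt poisson); apply: gen_alg0.
- by rewrite (ad_add adA) //; apply: gen_add.
- by rewrite (ad_mul adA) //; apply: gen_add; apply: gen_mul.
Qed.

Lemma ad_stable_above m n z a : ad_derivation_on br (A m) -> (m <= n)%N ->
  A m z -> A n a -> A n (br a z).
Proof.
move=> adA mn Az; apply: (der_stable_partial (der z) (leqnn n)) => j jn.
case: (ltnP j m) => [jm|mj].
  apply: partial_alg_mono mn _; apply: ad_stable => //.
  exact: partial_alg_var.
apply: partial_alg_mono jn _; apply: var_bracket_mem.
exact: partial_alg_mono mj _.
Qed.

(** If z = p(x_i), then {z, z} = 0 expresses p'(x_i) {x_i, z} through brackets
    with elements of A_i, in which z may be moved to the left entry. *)
Lemma var_antisym (i : 'I_N) z : ad_derivation_on br (A i) ->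
  (forall w a, A i.+1 w -> A i a -> br a w + br w a = 0) ->
  A i.+1 z -> br (x i) z + br z (x i) = 0.
Proof.
move=> adA anti Az; have [p Ap zE] := iffLR ((chain i).1 z) Az.
have up a : A i a -> A i.+1 a by apply: partial_alg_mono.
have Ax : A i.+1 (x i) by apply: partial_alg_var.
have swap w a : A i.+1 w -> A i a -> br w a = - br a w.
  by move=> Aw Aa; apply/eqP; rewrite -addr_eq0 addrC anti.
pose q := p^`().[x i]; pose S := \sum_(n < size p) \sum_(m < size p)
  br p`_m p`_n * x i ^+ m * x i ^+ n.
have S0 : S = 0.
  apply: (mulrSn_eq0 charK0 (n := 1)); rewrite mulr2n {1}/S exchange_big.
  rewrite -big_split big1 //= => n _; rewrite -big_split big1 //= => m _.
  by rewrite (ad_antisym poisson adA (Ap n) (Ap m)); ring.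
have zx : br z (x i) = \sum_(n < size p) br p`_n (x i) * x i ^+ n.
  rewrite {1}zE (der_horner (der _)) (br_alt poisson) mulr0 addr0.
  by rewrite map_horner // br0l.
have zp a : A i a -> br z a =
    \sum_(m < size p) br p`_m a * x i ^+ m - q * br a (x i).
  move=> Aa; rewrite {1}zE (der_horner (der _)) map_horner ?br0l //.
  by rewrite (swap _ _ Ax Aa) mulrN.
have qz : q * (br (x i) z + br z (x i)) = 0.
  have := br_alt poisson z.
  rewrite {1}zE (der_horner (der z)) map_horner ?br0l // -/q.
  rewrite (_ : \sum_(n < size p) _ = - S + q * br z (x i)).
    by rewrite S0 oppr0 add0r -mulrDr addrC.
  rewrite zx mulr_sumr -sumrN -big_split; apply: eq_bigr => n _ /=.
  rewrite -(opprK (br _ z)) -swap // zp // opprB mulrBl mulr_suml.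
  by rewrite addrC mulrA.
have [q0|q0] := chain_domain chain full qz; last by [].
have p'0 : p^`() = 0.
  apply: (chain i).2 q0 => n; rewrite coef_deriv -scaler_nat.
  exact/gen_algZ/Ap.
have sz1 : (size p <= 1)%N.
  apply/leq_sizeP => [] [|n] // _; apply: (mulrSn_eq0 charK0 (n := n)).
  by rewrite -coef_deriv p'0 coef0.
have Az0 : A i z by rewrite zE (size1_polyC sz1) hornerC.
by rewrite addrC; apply: anti.
Qed.

Lemma ad_derivation_succ (i : 'I_N) : ad_derivation_on br (A i) ->
  (forall w a, A i.+1 w -> A i a -> br a w + br w a = 0) ->
  ad_derivation_on br (A i.+1).
Proof.
move=> adA anti; apply: ad_derivation_from_vars => j ji.
have swap w : A i.+1 w -> br (x j) w = - br w (x j).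
  move=> Aw; apply/eqP; rewrite -addr_eq0; apply/eqP.
  move: ji; rewrite ltnS leq_eqVlt => /orP [/eqP/val_inj -> | ji].
    exact: var_antisym.
  by apply: anti => //; apply: partial_alg_var.
split=> [c a b Aa Ab|a b Aa Ab].
  rewrite !swap //; last exact/gen_add/Ab/gen_algZ.
  by rewrite (brDl poisson) (brZl poisson) opprD scalerN.
rewrite !swap //; last exact: gen_mul.
by rewrite (brMl poisson); ring.
Qed.

Lemma ad_derivation_succ_noncomm (i : 'I_N) a b :
  ad_derivation_on br (A i) -> A i a -> A i b -> br b a <> 0 ->
  ad_derivation_on br (A i.+1).
Proof.
move=> adA Aa Ab ba0; apply: ad_derivation_succ => // w.
move=> c _; apply: (ad_antisym_total charK0 poisson adA (a := a) (b := b)) => //.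
  exact: chain_domain.
by move=> f g Af Ag; apply: ad_stable.
Qed.

End Presentation.


Section WitnessVariable.
Variables (K : fieldType) (charK0 : has_pchar0 K) (r N : nat).
Variables (R : comAlgType K) (br : R -> R -> R).
Variables (act : {ffun 'I_r -> K} -> R -> R).
Variables (x : 'I_N -> R) (sigma delta : 'I_N -> R -> R).
Hypothesis pres : is_pcgl br act x sigma delta.
Local Notation A := (partial_alg x).
Let poisson := pcgl_poisson pres.
Let chain := pcgl_chain pres.
Let full := pcgl_full pres.
Let der z : derivation (br^~ z) := br_der poisson z.

Variable n : 'I_N.

Lemma within_add (B : R -> Prop) D a b :
  derivation_within B D -> B a -> B b -> D (a + b) = D a + D b.
Proof. by case=> + _ Ba Bb => /(_ 1 a b Ba Bb); rewrite !scale1r. Qed.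

(** The Jacobi identities for (x_n, b, z) and (x_n, b^2, z) express
    2 {x_n, b} {b, z} through brackets {z, -} with entries that depend on b
    only, hence as a derivation in z. *)
Lemma ad_as_derivation b : A n b -> exists2 F : R -> R, derivation F &
  forall z, A n (br b z) -> (br (x n) b *+ 2) * br b z = F z.
Proof.
move=> Ab; pose L := br (x n).
have dL : derivation_within (A n) L := var_bracket_derivation pres n.
exists (fun z => (b *+ 2) * br z (L b) + -1 * br z (L (b * b))) => [|z Abz].
  by apply: derivationD; apply: derivationM.
pose p := br b z; pose u := br b (br z (x n)).
pose w := br z (L b); pose v := br z (L (b * b)).
have J1 : L p + u + w = 0 := br_jacobi poisson (x n) b z.
have J2 : L (p * b + b * p) + (u * b + b * u) + v = 0.
  by rewrite -!(brMl poisson); apply: br_jacobi.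
have pb : A n (p * b) /\ A n (b * p) by split; apply: gen_mul.
rewrite (within_add dL pb.1 pb.2) !dL.2 // in J2.
rewrite -/(L b) -/p -/w -/v; set q := L p in J1 J2.
have -> : w = (q + u + w) - q - u by ring.
have -> : v = (q * b + p * L b + (L b * p + b * q) + (u * b + b * u) + v)
  - (q * b + p * L b + (L b * p + b * q) + (u * b + b * u)) by ring.
by rewrite J1 J2; ring.
Qed.

Variable b0 : R.
Hypotheses (Ab0 : A n b0) (Lb0 : br (x n) b0 <> 0).

(** For such z, all brackets {b, z} with b in A_n are within reach of
    ad_as_derivation. *)
Definition ad_preserves z : Prop := forall b, A n b -> A n (br b z).

Lemma ad_preserves_derivation b : A n b -> exists f : R, exists F : R -> R,
  [/\ f <> 0, derivation F & forall z, ad_preserves z -> f * br b z = F z].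
Proof.
move=> Ab; have mul2_neq0 (f : R) : f <> 0 -> f *+ 2 <> 0.
  by move=> f0 /(mulrSn_eq0 charK0).
have [Lb|/eqP Lb] := eqVneq (br (x n) b) 0; last first.
  have [F dF FE] := ad_as_derivation Ab.
  by exists (br (x n) b *+ 2), F; split=> [||z zP]; auto.
have Abb : A n (b + b0) by apply: gen_add.
have [F dF FE] := ad_as_derivation Abb.
have [G dG GE] := ad_as_derivation Ab0.
exists (br (x n) b0 *+ 2), (fun z => F z + -1 * G z); split=> [||z zP].
- exact: mul2_neq0.
- exact/derivationD/derivationM.
rewrite -FE ?GE -?GE; try exact: zP.
rewrite (within_add (var_bracket_derivation pres n)) // Lb add0r.
by rewrite (brDl poisson); ring.
Qed.

Lemma ad_preserves_var j : exists f : R, exists F : R -> R,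
  [/\ f <> 0, derivation_within (A n) F
    & forall z, ad_preserves z -> f * br (x j) z = F z].
Proof.
case: (ltnP j n) => [jn|nj].
  have [f [F [f0 dF FE]]] := ad_preserves_derivation (partial_alg_var x jn).
  by exists f, F; split=> //; apply: derivation_within_weaken.
exists 1, (br (x j)); split=> [||z _]; last by rewrite mul1r.
  by move/eqP; rewrite oner_eq0.
have [bl bm] := var_bracket_derivation pres j.
by split=> *; [apply: bl | apply: bm]; apply: partial_alg_mono nj _.
Qed.

Lemma ad_preserves_comb z z1 z2 (u1 u2 : R) :
  ad_preserves z -> ad_preserves z1 -> ad_preserves z2 ->
  (forall F, derivation_within (A n) F -> F z = u1 * F z1 + u2 * F z2) ->
  forall s, br s z = u1 * br s z1 + u2 * br s z2.
Proof.
move=> gz gz1 gz2 zE s.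
have dR := derivationD (derivationM (der z1) u1) (derivationM (der z2) u2).
apply: (der_eq_partial (der z) dR (m := N)) (full s) => j _.
have [f [F [f0 dF FE]]] := ad_preserves_var j.
apply: (chain_mulI chain full f0); rewrite FE // zE // mulrDr !(mulrCA f).
by rewrite !FE.
Qed.

Lemma ad_derivation_preserved m : (m <= n)%N ->
  (forall z, A m z -> ad_preserves z) -> ad_derivation_on br (A m).
Proof.
move=> mn good; have up z : A m z -> A n z by apply: partial_alg_mono.
split=> [c a b s Aa Ab|a b s Aa Ab].
  rewrite -[c *: br s a]mulr_algl -[br s b]mul1r.
  apply: ad_preserves_comb; try exact: good.
    exact/good/gen_add/Ab/gen_algZ.
  by move=> F [Fl _]; rewrite Fl ?mulr_algl ?mul1r //; apply: up.
apply: ad_preserves_comb; try exact: good.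
  exact/good/gen_mul.
by move=> F [_ Fm]; rewrite Fm; [ring | apply: up | apply: up].
Qed.

End WitnessVariable.


Section CommutativeStep.
Variables (K : fieldType) (charK0 : has_pchar0 K) (r N : nat).
Variables (R : comAlgType K) (br : R -> R -> R).
Variables (act : {ffun 'I_r -> K} -> R -> R).
Variables (x : 'I_N -> R) (sigma delta : 'I_N -> R -> R).
Hypothesis pres : is_pcgl br act x sigma delta.
Local Notation A := (partial_alg x).
Let poisson := pcgl_poisson pres.
Let chain := pcgl_chain pres.
Let full := pcgl_full pres.
Let der z : derivation (br^~ z) := br_der poisson z.

Lemma within_opp (B : R -> Prop) D a :
  derivation_within B D -> B 0 -> B a -> D (- a) = - D a.
Proof.
move=> dD B0 Ba; have D0 : D 0 = 0.
  by apply: (addrI (D 0)); rewrite -(within_add dD) // !addr0.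
by have := dD.1 (-1) a 0 Ba B0; rewrite !addr0 D0 addr0 !scaleN1r.
Qed.

Variables (n i j : 'I_N) (b0 c d : R).
Hypotheses (Ab0 : A n b0) (Lb0 : br (x n) b0 <> 0).
Hypotheses (lt_in : (i < n)%N) (lt_ji : (j < i)%N).
Hypotheses (adA : ad_derivation_on br (A i)).
Hypothesis comA : forall a b, A i a -> A i b -> br a b = 0.
Hypotheses (Ac : A i c) (Ad : A i d) (Ld : br (x i) d <> 0).
Hypothesis stable_var : forall z (m : 'I_N), A i.+1 z -> (m < i)%N -> m != j ->
  A n (br (x m) z).
Hypothesis stable_y : forall z, A i.+1 z -> A n (br (x j * x i - c) z).

Local Notation good := (ad_preserves br x n).

Let le_in : (i <= n)%N := ltnW lt_in.
Let up a : A i a -> A i.+1 a. Proof. exact: partial_alg_mono. Qed.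
Let up_n a : A i.+1 a -> A n a. Proof. exact: partial_alg_mono. Qed.
Let Axi : A i.+1 (x i). Proof. exact: partial_alg_var. Qed.
Let Axj : A i (x j). Proof. exact: partial_alg_var. Qed.
Let xj0 : x j <> 0. Proof. by case: (pcgl_eigen pres j). Qed.
Let mul0 (f g : R) : f * g = 0 -> f = 0 \/ g = 0.
Proof. exact: (chain_domain chain full). Qed.

(** The partial derivative of a with respect to x_j: modulo A_n, it is all that
    matters for derivations that send the other variables to A_n. *)
Lemma partial_derivative a : A i a -> exists2 a', A i a' &
  forall D : R -> R, derivation D ->
    (forall m : 'I_N, (m < i)%N -> m != j -> A n (D (x m))) ->
    A n (D a - a' * D (x j)).
Proof.
have up' b : A i b -> A n b by move/up/up_n.
elim=> {a} [k|_ [m mi ->]|a b Aa [a' Aa' aE] Ab [b' Ab' bE]|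
  a b Aa [a' Aa' aE] Ab [b' Ab' bE]].
- exists 0 => [|D dD _]; first exact: gen_alg0.
  by rewrite der_scalar // mul0r subrr; apply: gen_alg0.
- have [->|mj] := eqVneq m j.
    exists 1 => [|D _ _]; first exact: gen_alg1.
    by rewrite mul1r subrr; apply: gen_alg0.
  exists 0 => [|D _ Dx]; first exact: gen_alg0.
  by rewrite mul0r subr0; apply: Dx.
- exists (a' + b') => [|D dD Dx]; first exact: gen_add.
  rewrite der_add // mulrDl opprD addrACA.
  by apply: gen_add; [apply: aE | apply: bE].
exists (a' * b + a * b') => [|D dD Dx].
  by apply: gen_add; apply: gen_mul.
rewrite dD.2 (_ : _ - _ = (D a - a' * D (x j)) * b + a * (D b - b' * D (x j))).
  apply: gen_add; apply: gen_mul; try exact: up'; [exact: aE | exact: bE].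
by ring.
Qed.

Let partial_br a : A i a -> exists2 a', A i a' &
  forall z, A i.+1 z -> A n (br a z - a' * br (x j) z).
Proof.
move=> Aa; have [a' Aa' aE] := partial_derivative Aa.
by exists a' => // z Az; apply: (aE (br^~ z)) => // m; apply: stable_var.
Qed.

Lemma variation_xi : exists2 c', A i c' & forall z, A i.+1 z ->
  A n (x j * br (x i) z + (x i - c') * br (x j) z).
Proof.
have [c' Ac' cE] := partial_br Ac; exists c' => // z Az.
have := gen_add (stable_y Az) (cE z Az).
rewrite (brDl poisson) (brNl poisson) (brMl poisson).
by congr (A n _); ring.
Qed.

(** Only brackets with x_j and x_i can leave A_n, and both are determined by
    the one with x_j. *)
Lemma good_of_multiple z e : A i.+1 z -> A n e -> e <> 0 ->
  A n (e * br (x j) z) -> good z.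
Proof.
move=> Az Ae e0 AeP; have le_nN : (n <= N)%N by apply: ltnW.
have AP : A n (br (x j) z) := partial_alg_pure chain full le_nN Ae e0 AeP.
have [c' Ac' cE] := variation_xi.
have AT : A n (br (x i) z).
  apply: (partial_alg_pure chain full le_nN (up_n (up Axj)) xj0).
  have := gen_algB (cE z Az) (gen_mul (gen_algB (up_n Axi) (up_n (up Ac'))) AP).
  by rewrite addrK.
move=> a; apply: (der_stable_partial (der z) (leqnn n)) => m mn.
case: (ltngtP m i) => [mi|im|/val_inj -> //].
  by have [-> //|] := eqVneq m j; apply: stable_var.
apply: partial_alg_mono mn _; apply: (var_bracket_mem pres).
exact: partial_alg_mono im Az.
Qed.

Section Powers.
Variable a : R.
Hypothesis Aa : A i a.
Let b := x i + a.

Lemma Ab : A i.+1 b.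
Proof. by apply: gen_add => //; apply: up. Qed.

Lemma b_neq0 : b <> 0.
Proof.
move/eqP; rewrite addr_eq0 => /eqP xiE.
by apply: (@partial_alg_var_notin _ _ _ _ chain i); rewrite xiE; apply: gen_algN.
Qed.

Lemma variation_b : exists2 h, A i.+1 h /\ h <> 0 & forall z, A i.+1 z ->
  A n (x j * br b z - h * br (x j) z).
Proof.
have [c' Ac' cE] := variation_xi; have [a' Aa' aE] := partial_br Aa.
exists (x j * a' - (x i - c')) => [|z Az].
  split=> [|/eqP].
    apply: gen_algB; first exact/up/gen_mul.
    by apply: gen_algB => //; apply: up.
  rewrite subr_eq0 eq_sym subr_eq => /eqP xiE.
  apply: (@partial_alg_var_notin _ _ _ _ chain i); rewrite xiE.
  by apply: gen_add => //; apply: gen_mul.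
have := gen_add (cE z Az) (gen_mul (up_n (up Axj)) (aE z Az)).
by rewrite (brDl poisson); congr (A n _); ring.
Qed.

(** {z, z} = 0 for z = b^t z0 gives the multiple of {x_j, z} required by
    good_of_multiple; its coefficient is affine in t with nonzero slope. *)
Lemma good_power z0 h0 : A i.+1 z0 -> z0 <> 0 -> A i.+1 h0 ->
  (forall z, A i.+1 z -> A n (x j * br z0 z - h0 * br (x j) z)) ->
  exists2 s : R, s <> 0 & forall (k : K) t, k != 0 ->
    s *+ t + b * h0 <> 0 -> good (k *: (b ^+ t * z0)).
Proof.
move=> Az0 z00 Ah0 z0E; have [h [Ah h_neq0] bE] := variation_b.
exists (z0 * h) => [|k t k0 e0]; first exact: (chain_mul_neq0 chain full).
have Abt m : A i.+1 (b ^+ m).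
  elim: m => [|m IHm]; first by rewrite expr0; apply: gen_alg1.
  by rewrite exprS; exact: gen_mul Ab IHm.
set z := k *: _; have Az : A i.+1 z by exact: gen_algZ (gen_mul (Abt t) Az0).
apply: (good_of_multiple Az _ e0).
  apply/up_n/gen_add; last by apply: gen_mul => //; apply: Ab.
  rewrite -scaler_nat; exact/gen_algZ/gen_mul.
have zz : br (b ^+ t * z0) z = 0.
  have := br_alt poisson z; rewrite {1}/z (brZl poisson) => /eqP.
  by rewrite scaler_eq0 (negPf k0) => /eqP.
have rel : (z0 * br b z) *+ t + b * br z0 z = 0.
  clearbody z; case: t zz {e0} => [|t] zz.
    by move: zz; rewrite expr0 mul1r mulr0n add0r => ->; rewrite mulr0.
  have bt0 : b ^+ t <> 0.
    elim: t {zz} => [|t IHt]; first by move/eqP; rewrite expr0 oner_eq0.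
    by rewrite exprS; apply: (chain_mul_neq0 chain full) b_neq0 IHt.
  apply: (chain_mulf0 chain full bt0); rewrite -zz (brMl poisson).
  by rewrite (der_exp (der z)) exprS; ring.
have -> : (z0 * h *+ t + b * h0) * br (x j) z =
  - ((z0 * (x j * br b z - h * br (x j) z)) *+ t
     + b * (x j * br z0 z - h0 * br (x j) z)).
  by rewrite -[LHS]subr0 -(mulr0 (x j)) -rel; ring.
apply/gen_algN/gen_add; last first.
  by apply: gen_mul; [apply/up_n/Ab | apply: z0E].
rewrite -scaler_nat; apply/gen_algZ/gen_mul; [exact: up_n | exact: bE].
Qed.

End Powers.

Lemma good_base a (k : K) t : A i a -> k != 0 ->
  good (k *: (x i + a) ^+ t.+1).
Proof.
move=> Aa k0; have one0 : (1 : R) <> 0 by move/eqP; rewrite oner_eq0.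
have [|s s0 sE] := good_power Aa (gen_alg1 _) one0 (gen_alg0 _).
  by move=> z _; rewrite (br1l poisson) mulr0 mul0r subr0; apply: gen_alg0.
rewrite -[X in k *: X]mulr1; apply: sE k0 _.
by rewrite mulr0 addr0 => /(mulrSn_eq0 charK0).
Qed.

Let ell := br (x i) d.

Lemma variation_ell : exists2 h, A i.+1 h & forall z, A i.+1 z ->
  A n (x j * br ell z - h * br (x j) z).
Proof.
have [_ [[sA _ _] _] [[dA _ _] _] xE] := pcgl_ore pres i.
have [c' Ac' cE] := variation_xi.
have [s' As' sE] := partial_br (sA d Ad).
have [t' At' tE] := partial_br (dA d Ad).
exists (x j * (s' * x i + t') - sigma i d * (x i - c')) => [|z Az].
  have Axji := up Axj; have As'i := up As'; have At'i := up At'.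
  apply: gen_algB; apply: gen_mul => //.
  - by apply: gen_add => //; apply: gen_mul.
  - exact/up/sA.
  - by apply: gen_algB => //; apply: up.
have := gen_add (gen_mul (gen_mul (up_n (up Axj)) (up_n Axi)) (sE z Az))
  (gen_add (gen_mul (up_n (up (sA d Ad))) (cE z Az))
     (gen_mul (up_n (up Axj)) (tE z Az))).
by rewrite /ell (xE d Ad) (brDl poisson) (brMl poisson); congr (A n _); ring.
Qed.

(** At most one exponent is excluded, so one of the pairs (0, 1), (2, 3) is
    allowed. *)
Lemma good_ell a : A i a -> exists M, forall k : K, k != 0 ->
  good (k *: ((x i + a) ^+ M * ell)) /\ good (k *: ((x i + a) ^+ M.+1 * ell)).
Proof.
move=> Aa; have [h Ah hE] := variation_ell.
have [s s0 sE] := good_power Aa (var_bracket_mem pres Ad) Ld Ah hE.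
pose e t := s *+ t + (x i + a) * h.
have e_inj t m : e t = 0 -> e (t + m.+1)%N <> 0.
  rewrite /e mulrnDr addrAC => -> /eqP; rewrite add0r => /eqP.
  by move/(mulrSn_eq0 charK0).
have [e0|/eqP e0] := eqVneq (e 0%N) 0.
  exists 2%N => k k0; split; apply: sE => //; [exact: (e_inj 0%N 1%N) |].
  exact: (e_inj 0%N 2%N).
have [e1|/eqP e1] := eqVneq (e 1%N) 0; last first.
  by exists 0%N => k k0; split; apply: sE.
exists 2%N => k k0; split; apply: sE => //; [exact: (e_inj 1%N 0%N) |].
exact: (e_inj 1%N 1%N).
Qed.

Let comb := ad_preserves_comb charK0 pres Ab0 Lb0.

Let good_A a : A i a -> good a.
Proof. by move=> Aa b; apply: (ad_stable_above pres adA). Qed.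

Let good_b a : A i a -> good (x i + a).
Proof.
move=> Aa; have := @good_base a 1 0 Aa (oner_neq0 _).
by rewrite scale1r expr1.
Qed.

Let good_xi : good (x i).
Proof. by rewrite -[x i]addr0; apply/good_b/gen_alg0. Qed.

Lemma ad_shift a s : A i a -> br s (x i + a) = br s (x i) + br s a.
Proof.
move=> Aa; rewrite -[br s (x i)]mul1r -[br s a]mul1r.
apply: comb; [exact: good_b | exact: good_xi | exact: good_A |].
by move=> F dF; rewrite (within_add dF) ?mul1r //; apply: up_n => //; apply: up.
Qed.

Lemma br_A_xi a : A i a -> br a (x i) = - br (x i) a.
Proof.
move=> Aa; apply/eqP; rewrite -addr_eq0; apply/eqP.
have := br_alt poisson (x i + a); rewrite ad_shift // !(brDl poisson).
by rewrite !(br_alt poisson) add0r addr0.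
Qed.

(** The element c = (x_i + a)^M d is chosen so that the elements whose ad has
    to be known are scalar multiples of powers of x_i + a, or of such powers
    times {x_i, d}. *)
Lemma shift_defect_kill a z : A i a ->
  br (br (x i + a) z + br z (x i + a)) (x i + a) = 0.
Proof.
move=> Aa; have [M goodM] := good_ell Aa; set b := x i + a.
have bn0 : b <> 0 := b_neq0 Aa.
have An_b : A n b by apply/up_n/Ab.
pose g := - (b ^+ M * ell); pose w := b ^+ M * d.
have An_pow m : A n (b ^+ m).
  elim: m => [|m IHm]; first by rewrite expr0; apply: gen_alg1.
  by rewrite exprS; exact: gen_mul An_b IHm.
have An_ell : A n ell := up_n (var_bracket_mem pres Ad).
have An_g : A n g := gen_algN (gen_mul (An_pow M) An_ell).
have goodb : good b by apply: good_b.
have goodNb : good (- b).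
  by rewrite -scaleN1r -[b]expr1; apply: good_base; rewrite ?oppr_eq0 ?oner_eq0.
have goodbb : good (b * b).
  by rewrite -expr2 -[_ ^+ 2]scale1r; apply: good_base; rewrite ?oner_eq0.
have goodNbb : good (- (b * b)).
  by rewrite -expr2 -scaleN1r; apply: good_base; rewrite ?oppr_eq0 ?oner_eq0.
have goodg : good g.
  by rewrite /g -scaleN1r; case: (goodM (-1)); rewrite ?oppr_eq0 ?oner_eq0.
have goodNg : good (- g).
  by rewrite /g opprK -[b ^+ M * _]scale1r; case: (goodM 1); rewrite ?oner_eq0.
have two0 : (2%:R : K) != 0 by rewrite ((pcharf0P K).1 charK0).
have bgE : (b * g) *+ 2 = - 2%:R *: (b ^+ M.+1 * ell).
  by rewrite scaleNr scaler_nat /g exprS; ring.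
have goodbg : good ((b * g) *+ 2).
  by rewrite bgE; case: (goodM (- 2%:R)); rewrite ?oppr_eq0.
have goodNbg : good (- ((b * g) *+ 2)).
  by rewrite bgE scaleNr opprK; case: (goodM 2%:R).
have db : br d b = - ell.
  by rewrite /b ad_shift // br_A_xi // (comA Ad Aa) addr0.
have wb : br w b = g.
  by rewrite /w (brMl poisson) (brXl_self poisson) db /g; ring.
have An0 : A n 0 := gen_alg0 _.
have Nb s : br s (- b) = - br s b.
  rewrite [RHS](_ : _ = -1 * br s b + 0 * br s b); last by ring.
  by apply: comb => // F dF; rewrite (within_opp dF) //; ring.
have g0 : g <> 0.
  rewrite /g => /eqP; rewrite oppr_eq0 => /eqP.
  have := chain_mul_neq0 chain full _ Ld; apply.
  elim: M {goodM g w An_g goodg goodNg bgE goodbg goodNbg wb} => [|M IHM].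
    by move/eqP; rewrite expr0 oner_eq0.
  by rewrite exprS; apply: (chain_mul_neq0 chain full).
have [] // := mul0 (symmetric_defect_kill charK0 poisson z wb _ _ _ _ _).
- by rewrite Nb wb.
- rewrite (comb (z1 := b) (z2 := b) (u1 := b) (u2 := b)) // ?wb; first by ring.
  by move=> F dF; rewrite dF.2 //; ring.
- rewrite (comb (z1 := b) (z2 := b) (u1 := - b) (u2 := - b)) // ?wb.
    by ring.
  move=> F dF; rewrite (within_opp dF) //; last exact: gen_mul.
  by rewrite dF.2 //; ring.
- move=> s; rewrite (comb (z1 := g) (z2 := b) (u1 := b *+ 2) (u2 := g *+ 2)) //.
    by ring.
  have Abg := gen_mul An_b An_g.
  by move=> F dF; rewrite !mulr2n (within_add dF) // dF.2 //; ring.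
move=> s; rewrite (comb (z1 := - g) (z2 := b) (u1 := b *+ 2) (u2 := - (g *+ 2))) //.
  by ring.
have Abg := gen_mul An_b An_g; have Abg2 := gen_add Abg Abg.
move=> F dF; rewrite !mulr2n (within_opp dF) // (within_add dF) // dF.2 //.
by rewrite (within_opp dF) //; ring.
Qed.

Lemma ad_derivation_succ_comm : ad_derivation_on br (A i.+1).
Proof.
have Ld' : br d (x i) <> 0 by rewrite br_A_xi // => /eqP; rewrite oppr_eq0 => /eqP.
apply: (ad_derivation_succ charK0 pres adA) => z a _.
suff key b : A i b -> br b (x i) <> 0 -> br b z + br z b = 0.
  move=> Aa; have [ax0|/eqP ax0] := eqVneq (br a (x i)) 0; last exact: key.
  have := key (a + d) (gen_add Aa Ad); rewrite !(brDl poisson) ax0 add0r.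
  by rewrite (ad_add adA) // addrACA (key d Ad Ld') addr0; apply.
move=> Ab bx0; have [|a' Aa' _|//|//] := mul0
  (symmetric_defect_polarize charK0 poisson adA (e := x i) (z := z) Ab _ _).
  by move=> a' s; apply: ad_shift.
exact: shift_defect_kill.
Qed.

End CommutativeStep.


Section AdDerivationBelow.
Variables (K : fieldType) (charK0 : has_pchar0 K) (r N : nat).
Variables (R : comAlgType K) (br : R -> R -> R).
Variables (act : {ffun 'I_r -> K} -> R -> R).
Variables (x : 'I_N -> R) (sigma delta : 'I_N -> R -> R).
Variables (eta : 'I_N -> int) (y : 'I_N -> R).
Hypothesis pres : is_pcgl br act x sigma delta.
Hypothesis assoc : associated br act x eta y.
Local Notation A := (partial_alg x).

Lemma var_bracket_neq0 m : eta_pred eta m <> None ->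
  exists2 b, A m b & br (x m) b <> 0.
Proof.
move=> pm; have [b Ab sb] := sigma_neq0 pres assoc pm; exists b => //.
have [_ [[sA _ _] _] [[dA _ _] _] xE] := pcgl_ore pres m.
rewrite xE // => xb0; apply: sb.
have [] // := linear_inj (pcgl_chain pres m) (sA b Ab) (dA b Ab)
  (gen_alg0 _) (gen_alg0 _) _.
by rewrite xb0 mul0r addr0.
Qed.

Lemma y_first j : eta_pred eta j = None -> y j = x j.
Proof.
move=> pj; rewrite (y_rec x eta y j) (y_tail_None assoc pj) subr0 /y_pred pj.
by rewrite mul1r.
Qed.

Lemma prime_bracket_mem (j i : 'I_N) z : (j <= i)%N -> succ_gt eta j i ->
  A i.+1 z -> A i.+1 (br (y j) z).
Proof.
move=> ji sji Az; have pr := y_prime assoc ji sji.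
have [_ /(_ z Az) [b Ab ->]] := prime_normal pr.
by apply: gen_mul => //; case: (prime_normal pr).
Qed.

(** If the bracket vanishes on A_i, then y_l = x_l for l < i, and y_i is x_i or
    x_j x_i - c with j = p(i). Except for x_j in the second case, all these
    elements are Poisson-prime in A_(i+1), so that their brackets with A_(i+1)
    stay in A_(i+1). *)
Lemma ad_derivation_below (n : 'I_N) : eta_pred eta n <> None ->
  forall m, (m <= n)%N -> ad_derivation_on br (A m).
Proof.
move=> pn; have [b0 Ab0 Lb0] := var_bracket_neq0 pn.
elim=> [_|m IHm lt_mn]; first exact: (ad_derivation0 pres).
pose i := Ordinal (ltn_trans lt_mn (ltn_ord n)).
have lt_in : (i < n)%N := lt_mn; have {IHm} adA := IHm (ltnW lt_mn).
have up_n a : A i.+1 a -> A n a by apply: partial_alg_mono.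
have [[a [b [Aa Ab ba0]]] | com] :=
  classic (exists a b, [/\ A i a, A i b & br b a <> 0]).
  exact: (ad_derivation_succ_noncomm charK0 pres (i := i) adA Aa Ab ba0).
have {}com a b : A i a -> A i b -> br a b = 0.
  by move=> Aa Ab; apply: NNPP => ab0; apply: com; exists b, a.
have first (l : 'I_N) : (l < i)%N -> eta_pred eta l = None.
  move=> li; case pl: (eta_pred eta l) => [j|] //.
  have [|b Ab []] := @var_bracket_neq0 l; first by rewrite pl.
  by apply: com; [apply: partial_alg_var | apply: partial_alg_mono (ltnW li) Ab].
have stable_var z (l : 'I_N) : A i.+1 z -> (l < i)%N ->
    eta_pred eta i <> Some l -> A n (br (x l) z).
  move=> Az li pi_l; rewrite -y_first; last exact: first.
  apply/up_n/prime_bracket_mem => //; first exact: ltnW.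
  apply/succ_gtP=> h ph; rewrite ltnNge; apply/negP.
  rewrite leq_eqVlt => /orP [/eqP/val_inj hi | /first]; last by rewrite ph.
  by apply: pi_l; rewrite -hi.
case pi_: (eta_pred eta i) => [j|]; last first.
  apply: (ad_derivation_preserved charK0 pres Ab0 Lb0) => // z Az a.
  apply: (der_stable_partial (br_der (pcgl_poisson pres) z) (leqnn n)) => l ln.
  case: (ltngtP l i) => [li|il|/val_inj ->].
  - by apply: stable_var => //; rewrite pi_.
  - apply: partial_alg_mono ln _; apply: (var_bracket_mem pres).
    exact: partial_alg_mono il Az.
  rewrite -(y_first pi_); apply/up_n/prime_bracket_mem => //.
  exact: succ_gt_self.
have ji := eta_pred_lt pi_.
have [|d Ad Ld] := @var_bracket_neq0 i; first by rewrite pi_.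
apply: (ad_derivation_succ_comm charK0 pres Ab0 Lb0 lt_in ji adA com
  (y_tail_mem assoc i) Ad Ld).
  by move=> z l Az li lj; apply: stable_var; rewrite // pi_ => -[jl];
    rewrite jl eqxx in lj.
move=> z Az; apply: up_n.
have -> : x j * x i - y_tail x eta y i = y i.
  by rewrite [RHS](y_rec x eta y i) /y_pred pi_ -y_first ?first.
by apply: prime_bracket_mem => //; apply: succ_gt_self.
Qed.

End AdDerivationBelow.


(** * Comparing two presentations *)

Lemma poisson_prime_ext (K : fieldType) (R : comAlgType K) br
    (A B : R -> Prop) c : (forall a, A a <-> B a) ->
  poisson_prime br A c -> poisson_prime br B c.
Proof.
move=> AB [c0 [Ac nc] prop dom].
have ideal a : in_principal A c a <-> in_principal B c a.
  by split=> -[b /AB Bb ->]; exists b.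
split=> //.
- by split=> [|a /AB Aa]; [apply/AB | apply/ideal/nc].
- by move/ideal.
by move=> a b /AB Aa /AB Ab /ideal /(dom a b Aa Ab) []; [left|right]; apply/ideal.
Qed.

Lemma associated_ext (K : fieldType) (r : nat) (R : comAlgType K)
    (br : R -> R -> R) (act : {ffun 'I_r -> K} -> R -> R) (N : nat)
    (x : 'I_N -> R) (e e' : 'I_N -> int) (y : 'I_N -> R) :
  eta_pred e =1 eta_pred e' -> associated br act x e y ->
  associated br act x e' y.
Proof.
move=> pE [c [hc yE hy ly]]; exists c; split=> //.
- by move=> k; rewrite -pE; apply: hc.
- by move=> k; rewrite -pE; apply: yE.
move=> k; have [l1 l2 l3] := ly k; split=> /=.
- by move=> j; rewrite -(eq_succ_gt pE); apply: l1.
- by move=> d hd /(l2 d hd) [j]; rewrite /= (eq_succ_gt pE); exists j.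
by move=> i j; rewrite -!(eq_succ_gt pE); apply: l3.
Qed.

Section Swap.
Variables (K : fieldType) (r N : nat) (R : comAlgType K) (br : R -> R -> R).
Variables (act : {ffun 'I_r -> K} -> R -> R) (x x' : 'I_N -> R).
Variables (sigma delta sigma' delta' : 'I_N -> R -> R).
Variables (k k1 : 'I_N) (eta eta' : 'I_N -> int) (y y' : 'I_N -> R).
Hypothesis k1E : nat_of_ord k1 = k.+1.
Hypothesis xE : forall j, x' j = x (tperm k k1 j).
Hypothesis pres : is_pcgl br act x sigma delta.
Hypothesis assoc : associated br act x eta y.
Hypothesis pres' : is_pcgl br act x' sigma' delta'.
Hypothesis assoc' : associated br act x' eta' y'.
Local Notation A := (partial_alg x).
Local Notation A' := (partial_alg x').
Local Notation tau := (tperm k k1).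
Let chain := pcgl_chain pres.
Let chain' := pcgl_chain pres'.
Let full := pcgl_full pres.

Let kk1 : (k <= k1)%N. Proof. by rewrite k1E. Qed.
Let x'k : x' k = x k1. Proof. by rewrite xE tpermL. Qed.
Let x'k1 : x' k1 = x k. Proof. by rewrite xE tpermR. Qed.

Lemma tau_lt (j : 'I_N) (m : nat) : m != k.+1 -> (j < m)%N -> (tau j < m)%N.
Proof.
move=> mk jm; case: tpermP => [jk | jk1 | //]; last by rewrite jk1 in jm; lia.
by rewrite k1E; rewrite jk in jm; lia.
Qed.

Lemma swap_sub (m : nat) a : m != k.+1 -> A' m a -> A m a.
Proof.
move=> mk; elim=> [c|_ [j jm ->]|b c _ IHb _ IHc|b c _ IHb _ IHc].
- exact: gen_scalar.
- by rewrite xE; apply/partial_alg_var/tau_lt.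
- exact: gen_add.
- exact: gen_mul.
Qed.

Lemma swap_sup (m : nat) a : m != k.+1 -> A m a -> A' m a.
Proof.
move=> mk; elim=> [c|_ [j jm ->]|b c _ IHb _ IHc|b c _ IHb _ IHc].
- exact: gen_scalar.
- by rewrite -(tpermK k k1 j) -xE; apply/partial_alg_var/tau_lt.
- exact: gen_add.
- exact: gen_mul.
Qed.

Let k_ne : (k : nat) != k.+1. Proof. by rewrite -[k.+1]addn1; lia. Qed.
Let k2_ne : k1.+1 != k.+1. Proof. by rewrite k1E; lia. Qed.

Lemma up_k1 a : A k a -> A k1 a.
Proof. exact: partial_alg_mono. Qed.

(** The second presentation gives coefficients with respect to x_(k+1) that do
    not involve x_k, and the first one says that coefficients are unique. *)
Lemma swap_descent a b : A k1 a -> A k1 b -> A' k1 (a * x k1 + b) ->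
  A k a /\ A k b.
Proof.
move=> Aa Ab; rewrite [in A' _]k1E => Cab.
have polyk' := chain' k; rewrite x'k in polyk'.
have [|A'a A'b] := linear_descent (chain k1) polyk' _ Aa Ab Cab.
- by move=> c /(swap_sub k_ne)/up_k1.
by split; apply: swap_sub.
Qed.

Lemma swap_inter a : A k1 a -> A' k1 a -> A k a.
Proof.
move=> Aa A'a; have [] // := @swap_descent 0 a (gen_alg0 _) Aa.
by rewrite mul0r add0r.
Qed.

Lemma y'_scale (j : 'I_N) : j != k -> j != k1 ->
  exists2 a : K, a != 0 & y' j = a *: y j.
Proof.
move=> jk jk1; have jne : (j : nat) != k.+1 by rewrite -k1E.
have jne1 : j.+1 != k.+1 by rewrite eqSS.
apply: (new_prime assoc); first exact: y_homogeneous assoc' j.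
  apply: poisson_prime_ext (y_prime assoc' (leqnn j) (succ_gt_self eta' j)).
  by move=> a; split; [apply: swap_sub | apply: swap_sup].
by move/(swap_sup jne); apply: (y_notin pres' assoc').
Qed.

Lemma prime_swap (j : 'I_N) : (j <= k1)%N -> succ_gt eta j k1 ->
  poisson_prime br (A' k1.+1) (y j).
Proof.
move=> jk1 sj; apply: poisson_prime_ext (y_prime assoc jk1 sj) => a.
by split; [apply: swap_sup | apply: swap_sub].
Qed.

Section DifferentLevels.
Hypothesis eta_ne : eta k <> eta k1.

Lemma y_k_scale : exists2 a : K, a != 0 & y k = a *: y' k1.
Proof.
apply: (new_prime assoc'); first exact: y_homogeneous assoc k.
  apply: prime_swap => //; apply/succ_gtP=> i pi.
  have [ki ei _] := eta_pred_Some pi.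
  rewrite ltn_neqAle k1E ki andbT; apply/eqP=> kiE; apply: eta_ne.
  by rewrite ei; congr eta; apply: val_inj; rewrite /= -kiE.
have Ay : A k1 (y k) by rewrite k1E; apply: (y_mem assoc).
by move/(swap_inter Ay); apply: (y_notin pres assoc).
Qed.

Lemma y_k1_scale : exists2 a : K, a != 0 & y k1 = a *: y' k.
Proof.
have [b b0 ykE] := y_k_scale; case: assoc' => c [_ _ _ /(_ k1)] [_ + _].
case/(_ _ (y_homogeneous assoc k1)).
  exact/prime_swap/succ_gt_self.
move=> j /andP [jk1 _] [a a0 yE]; exists a => //; rewrite yE; congr (_ *: y' _).
apply/val_inj; move: jk1; rewrite leq_eqVlt => /orP [/eqP/val_inj jE|].
  have yk : y k = (b / a) *: y k1 by rewrite ykE yE jE scalerA divfK.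
  have ba0 : b / a != 0 by rewrite mulf_neq0 ?invr_eq0.
  by have := congr1 val (y_scale_inj pres assoc ba0 yk) => /=; lia.
rewrite k1E ltnS leq_eqVlt => /orP [/eqP //|jk].
case: (y_notin pres assoc (j := k1)); rewrite yE; apply/gen_algZ/up_k1.
apply: (swap_sub k_ne); exact: partial_alg_mono jk (y_mem assoc' j).
Qed.

End DifferentLevels.

Lemma y'_k_lead (a : K) : y' k = a *: y k1 ->
  y_pred eta' y' k = a *: y_pred eta y k1.
Proof.
rewrite (y_rec x' eta' y' k) (y_rec x eta y k1) scalerDr scalerAl x'k.
case/(linear_inj (chain k1)) => //.
- exact/up_k1/(swap_sub k_ne)/(y_pred_mem assoc').
- exact/up_k1/(swap_sub k_ne)/(y_tailN_mem assoc').
- exact/gen_algZ/(y_pred_mem assoc).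
- exact/gen_algZ/(y_tailN_mem assoc).
Qed.

Lemma y'_lead (j : 'I_N) (a : K) : j != k -> j != k1 -> y' j = a *: y j ->
  y_pred eta' y' j = a *: y_pred eta y j.
Proof.
move=> jk jk1; have jne : (j : nat) != k.+1 by rewrite -k1E.
rewrite (y_rec x' eta' y' j) (y_rec x eta y j) scalerDr scalerAl.
rewrite xE tpermD 1?eq_sym //.
case/(linear_inj (chain j)) => //.
- exact/(swap_sub jne)/(y_pred_mem assoc').
- exact/(swap_sub jne)/(y_tailN_mem assoc').
- exact/gen_algZ/(y_pred_mem assoc).
- exact/gen_algZ/(y_tailN_mem assoc).
Qed.

Lemma pred_k1 : eta k = eta k1 -> eta_pred eta k1 = Some k.
Proof. by move=> ek; apply: eta_pred_intro => // [|i]; rewrite k1E. Qed.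

Section SameLevel.
Hypothesis eta_eq : eta k = eta k1.

Lemma y_k1_rec : y k1 = y k * x k1 + - y_tail x eta y k1.
Proof. by rewrite [LHS](y_rec x eta y k1) /y_pred (pred_k1 eta_eq). Qed.

Lemma y_k_mem : A k1 (y k).
Proof. by rewrite k1E; apply: (y_mem assoc). Qed.

Lemma y_k1_notin' : ~ A' k1 (y k1).
Proof.
rewrite y_k1_rec => /(swap_descent y_k_mem (y_tailN_mem assoc k1)) [Ay _].
exact: (y_notin pres assoc Ay).
Qed.

Lemma y_k1_scale_same : exists2 a : K, a != 0 & y k1 = a *: y' k1.
Proof.
apply: (new_prime assoc'); first exact: y_homogeneous assoc k1.
  exact/prime_swap/succ_gt_self.
exact: y_k1_notin'.
Qed.

(** Comparison of the coefficients of x_k x_(k+1). *)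
Lemma y_k_lead (a : K) : eta' k = eta' k1 -> y k1 = a *: y' k1 ->
  y_pred eta y k = a *: y_pred eta' y' k.
Proof.
move=> eta'_eq yE; have p'k1 : eta_pred eta' k1 = Some k.
  by apply: eta_pred_intro => // [|i]; rewrite k1E.
pose q := y_pred eta y k; pose q' := y_pred eta' y' k.
pose t := y_tail x eta y k; pose t' := y_tail x' eta' y' k.
pose s := y_tail x eta y k1; pose s' := y_tail x' eta' y' k1.
have ykE : y k = q * x k + - t := y_rec x eta y k.
have y'kE : y' k = q' * x k1 + - t' by rewrite (y_rec x' eta' y' k) x'k.
have y'k1E : y' k1 = y' k * x k + - s'.
  by rewrite [LHS](y_rec x' eta' y' k1) /y_pred p'k1 x'k1.
have Aq : A k q := y_pred_mem assoc k.
have Aq' : A k q' := swap_sub k_ne (y_pred_mem assoc' k).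
have At : A k t := y_tail_mem assoc k.
have At' : A k t' := swap_sub k_ne (y_tail_mem assoc' k).
have Axk : A k1 (x k) by rewrite k1E; apply: partial_alg_var.
have [] := @swap_descent (a *: (q' * x k) - y k) (s - a *: (t' * x k)).
- by apply: gen_algB; [apply/gen_algZ/gen_mul => //; apply: up_k1 | apply: y_k_mem].
- apply: gen_algB; first exact: (y_tail_mem assoc).
  by apply/gen_algZ/gen_mul => //; apply: up_k1.
- have -> : (a *: (q' * x k) - y k) * x k1 + (s - a *: (t' * x k)) = a *: s'.
    have -> : s' = y' k * x k - y' k1 by rewrite y'k1E; ring.
    rewrite scalerBr -yE y_k1_rec -/s y'kE.
    have -> : (q' * x k1 + - t') * x k = q' * x k * x k1 - t' * x k by ring.
    by rewrite scalerBr (scalerAl a (q' * x k)); ring.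
  exact/gen_algZ/(y_tail_mem assoc').
move=> Aqq _; apply/eqP; rewrite eq_sym -subr_eq0; apply/eqP.
have [] // := linear_inj (chain k) (a := a *: q' - q) (b := t) (a' := 0)
  (b' := a *: (q' * x k) - y k).
- by apply: gen_algB => //; apply: gen_algZ.
- exact: gen_alg0.
by rewrite mul0r add0r ykE mulrBl -scalerAl; ring.
Qed.

End SameLevel.

End Swap.


Section Identification.
Variables (K : fieldType) (r N : nat) (R : comAlgType K) (br : R -> R -> R).
Variables (act : {ffun 'I_r -> K} -> R -> R) (x x' : 'I_N -> R).
Variables (sigma delta sigma' delta' : 'I_N -> R -> R).
Variables (k k1 : 'I_N) (eta eta' : 'I_N -> int) (y y' : 'I_N -> R).
Hypothesis k1E : nat_of_ord k1 = k.+1.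
Hypothesis xE : forall j, x' j = x (tperm k k1 j).
Hypothesis pres : is_pcgl br act x sigma delta.
Hypothesis assoc : associated br act x eta y.
Hypothesis pres' : is_pcgl br act x' sigma' delta'.
Hypothesis assoc' : associated br act x' eta' y'.
Local Notation tau := (tperm k k1).

Let xE' j : x j = x' (tau j).
Proof. by rewrite xE tpermK. Qed.

Let unscale (a : K) (u v : R) : a != 0 -> u = a *: v -> v = a^-1 *: u.
Proof. by move=> a0 ->; rewrite scalerK. Qed.

(** By induction the predecessors of the two presentations correspond to each
    other, and comparing leading coefficients shows that the scalars between
    corresponding primes are 1. *)
Lemma identify_distinct : eta k <> eta k1 -> forall j,
  y' j = y (tau j) /\ omap tau (eta_pred eta' j) = eta_pred eta (tau j).
Proof.
move=> eta_ne.
have scale j : exists2 a : K, a != 0 & y' j = a *: y (tau j).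
  case: tpermP => [->|->|/eqP jk /eqP jk1].
  - have [a a0 yE] := y_k1_scale k1E xE pres assoc pres' assoc' eta_ne.
    by exists a^-1; rewrite ?invr_eq0 // yE scalerK.
  - have [a a0 yE] := y_k_scale k1E xE pres assoc pres' assoc' eta_ne.
    by exists a^-1; rewrite ?invr_eq0 // yE scalerK.
  exact: (y'_scale k1E xE assoc pres' assoc').
have lead j (a : K) : a != 0 -> y' j = a *: y (tau j) ->
    y_pred eta' y' j = a *: y_pred eta y (tau j).
  move=> a0; case: tpermP => [->|->|/eqP jk /eqP jk1].
  - exact: (y'_k_lead k1E xE pres assoc assoc').
  - move/(unscale a0)/(y'_k_lead k1E xE' pres' assoc' assoc) => ->.
    by rewrite scalerA divff // scale1r.
  - exact: (y'_lead k1E xE pres assoc assoc').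
move=> j; have [m] := ubnP (val j); elim: m j => // m IHm j; rewrite ltnS => jm.
have [a a0 yE] := scale j; have := lead j a a0 yE; rewrite /y_pred.
have -> : (if eta_pred eta' j is Some i then y' i else 1) =
    oapp y 1 (omap tau (eta_pred eta' j)).
  case pj: eta_pred => [i|] //=; have [] // := IHm i.
  exact: leq_trans (eta_pred_lt pj) jm.
move/esym/(y_option_inj pres assoc a0) => [-> a1].
by rewrite yE a1 scale1r.
Qed.

(** If eta' separated k and k + 1, then y_(k+1) would be a multiple of y'_k,
    which does not involve x_k, whereas the leading coefficient y_k of y_(k+1)
    does. *)
Lemma same_level : eta k = eta k1 -> eta' k = eta' k1.
Proof.
move=> eta_eq; apply/eqP/negPn/negP => /eqP eta'_ne.
have [a a0 y'E] := y_k_scale k1E xE' pres' assoc' pres assoc eta'_ne.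
apply: (y_k1_notin' k1E xE pres assoc pres' eta_eq).
rewrite (unscale a0 y'E) k1E; exact/gen_algZ/(y_mem assoc').
Qed.

Lemma identify_same : eta k = eta k1 ->
  (forall j, j != k -> y' j = y j) /\ eta_pred eta' =1 eta_pred eta.
Proof.
move=> eta_eq; have eta'_eq := same_level eta_eq.
have p_k1 := pred_k1 k1E eta_eq; have p'_k1 := pred_k1 k1E eta'_eq.
(* For j = k + 1, the predecessor of k matters: that of k + 1 is k. *)
pose f j := if j == k1 then k else j.
suff key j : j != k -> y' j = y j /\ eta_pred eta' (f j) = eta_pred eta (f j).
  split=> [j jk|j]; first by case: (key j jk).
  have k1k : k1 != k by apply/eqP=> /(congr1 val); rewrite /= k1E; lia.
  have [->|jk] := eqVneq j k; first by case: (key k1 k1k); rewrite /f eqxx.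
  have [->|jk1] := eqVneq j k1; first by rewrite p'_k1 p_k1.
  by case: (key j jk); rewrite /f (negPf jk1).
have lead i : i != k -> exists2 a : K, a != 0 &
    y' i = a *: y i /\ y_pred eta' y' (f i) = a *: y_pred eta y (f i).
  rewrite /f => ik; have [->|ik1] := eqVneq i k1.
    have [a a0 yE] := y_k1_scale_same k1E xE pres assoc pres' assoc' eta_eq.
    exists a^-1; rewrite ?invr_eq0 // (y_k_lead k1E xE pres assoc pres' assoc'
      eta_eq eta'_eq yE) yE !scalerA mulVf // !scale1r.
    by [].
  have [a a0 yE] := y'_scale k1E xE assoc pres' assoc' ik ik1.
  exists a => //; split=> //.
  exact: (y'_lead k1E xE pres assoc assoc' ik ik1 yE).
have [m] := ubnP (val j); elim: m j => // m IHm j; rewrite ltnS => jm jk.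
have [a a0 [yE]] := lead j jk; rewrite /y_pred.
have -> : (if eta_pred eta' (f j) is Some i then y' i else 1) =
    oapp y 1 (eta_pred eta' (f j)).
  case pj: eta_pred => [i|] //=.
  have [ij ik] : (i < j)%N /\ i != k.
    move: pj; rewrite /f; case: eqP => [->|jk1] pj.
      have ik := eta_pred_lt pj; split; first by rewrite k1E ltnW.
      by apply/eqP=> iE; rewrite iE ltnn in ik.
    split; first exact: eta_pred_lt pj.
    apply/eqP=> iE; apply: jk1; rewrite iE in pj.
    exact: eta_pred_inj pj p'_k1.
  by have [] := IHm i (leq_trans ij jm) ik.
move/esym/(y_option_inj pres assoc a0) => [-> a1].
by rewrite yE a1 scale1r.
Qed.

Lemma eta_pred_swap :
  eta_pred eta' =1 eta_pred (fun j => eta (tau j)).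
Proof.
have [eta_eq|/eqP eta_ne] := eqVneq (eta k) (eta k1).
  have [_ pE] := identify_same eta_eq; move=> j; rewrite pE.
  have tauE i : eta (tau i) = eta i by case: tpermP => // ->.
  by apply: eq_pick => i; rewrite !tauE; congr [&& _, _ & _];
    apply: eq_forallb => l; rewrite tauE.
have tau_lt_eq i j : eta (tau i) = eta (tau j) -> (tau i < tau j)%N = (i < j)%N.
  case: tpermP => [->|->|/eqP ik /eqP ik1];
    case: tpermP => [->|->|/eqP jk /eqP jk1] // ek;
    first [ by rewrite !ltnn | by case: (eta_ne ek)
          | by case: (eta_ne (esym ek)) | rewrite !k1E ].
  - by move: jk jk1; rewrite -!val_eqE /= k1E; lia.
  - by move: jk jk1; rewrite -!val_eqE /= k1E; lia.
  - by move: ik ik1; rewrite -!val_eqE /= k1E; lia.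
  - by move: ik ik1; rewrite -!val_eqE /= k1E; lia.
move=> j; have [_] := identify_distinct eta_ne j.
case pj: (eta_pred eta' j) => [i|] /=; case qj: (eta_pred eta (tau j)) => [l|] //.
  case=> iE; rewrite -{l}iE in qj; apply/esym/eta_pred_intro.
  - exact: eta_pred_lt pj.
  - by have [_ ] := eta_pred_Some qj.
  move=> l lj le; have [_ ij max_i] := eta_pred_Some qj.
  have := max_i (tau l); rewrite tau_lt_eq // => /(_ lj le).
  rewrite leqNgt => il; rewrite leqNgt; apply/negP=> /= lt_il.
  by case/negP: il; rewrite tau_lt_eq // ij le.
move=> _; case p2: (eta_pred _ j) => [l|] //.
have [lj le _] := eta_pred_Some p2.
by case: (eta_pred_None qj (i := tau l)); rewrite ?tau_lt_eq.
Qed.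

End Identification.


(** * The element y_k y'_k - y_(p(k)) y_(k+1) *)

(** The multiplier D(a) is unique since the algebra is a domain, and uniqueness
    makes D a derivation. *)
Lemma normalize_same_way_intro (K : fieldType) (R : comAlgType K)
    (br : R -> R -> R) (S : R -> Prop) (u v : R) :
  (forall f g : R, f * g = 0 -> f = 0 \/ g = 0) ->
  ad_derivation_on br (gen_alg S) -> u <> 0 -> v <> 0 ->
  (forall a, gen_alg S a -> exists2 d, gen_alg S d &
     br u a = d * u /\ br v a = d * v) ->
  normalize_same_way br (gen_alg S) u v.
Proof.
move=> dom adB u0 v0 mult.
pose P a d := gen_alg S d /\ br u a = d * u /\ br v a = d * v.
pose D a := epsilon (inhabits 0) (P a).
have DP a : gen_alg S a -> P a (D a).
  by case/mult=> d Bd duv; apply: epsilon_spec; exists d.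
have cancel d e : d * u = e * u -> d = e.
  move/eqP; rewrite -subr_eq0 -mulrBl => /eqP /dom [/eqP | //].
  by rewrite subr_eq0 => /eqP.
exists D; split.
- split=> [a /DP [] //|c a b Ba Bb|a b Ba Bb]; apply: cancel.
    have [_ [<- _]] := DP _ (gen_add (gen_algZ c Ba) Bb).
    have [[_ [aE _]] [_ [bE _]]] := (DP a Ba, DP b Bb).
    by rewrite (ad_linear adB) // aE bE mulrDl scalerAl.
  have [_ [<- _]] := DP _ (gen_mul Ba Bb).
  have [[_ [aE _]] [_ [bE _]]] := (DP a Ba, DP b Bb).
  by rewrite (ad_mul adB) // aE bE; ring.
- by split=> // a /DP [_ [-> _]].
by split=> // a /DP [_ [_ ->]].
Qed.

Section Multiplier.
Variables (K : fieldType) (r N : nat) (R : comAlgType K) (br : R -> R -> R).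
Variables (act : {ffun 'I_r -> K} -> R -> R) (x : 'I_N -> R).
Variables (sigma delta : 'I_N -> R -> R) (eta : 'I_N -> int) (y : 'I_N -> R).
Hypothesis pres : is_pcgl br act x sigma delta.
Hypothesis assoc : associated br act x eta y.
Local Notation A := (partial_alg x).

(** Comparison of the coefficients of x_j in {y_j, a} = d y_j. *)
Lemma y_multiplier (j : 'I_N) a : ad_derivation_on br (A j) -> A j a ->
  exists2 d, A j d & br (y j) a = d * y j /\
    d * y_pred eta y j =
      br (y_pred eta y j) a + y_pred eta y j * sigma j a.
Proof.
move=> adA Aa; have poisson := pcgl_poisson pres.
have [_ [[sA _ _] _] [[dA _ _] _] xE] := pcgl_ore pres j.
have pr := y_prime assoc (leqnn j) (succ_gt_self eta j).
have [_ /(_ a (partial_alg_mono (leqnSn j) Aa)) [d Ad dE]] := prime_normal pr.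
have Aq := y_pred_mem assoc j; have At := y_tail_mem assoc j.
have [] := linear_divisor (pcgl_chain pres j)
  (partial_alg_domain (pcgl_chain pres) (ltnW (ltn_ord j)))
  Aq (y_tailN_mem assoc j) (@y_pred_neq0 _ _ _ _ _ _ _ _ _ assoc j) Ad
  (f := br (y_pred eta y j) a + y_pred eta y j * sigma j a)
  (g := y_pred eta y j * delta j a - br (y_tail x eta y j) a).
- apply: gen_add; first exact: (ad_stable pres).
  by apply: gen_mul => //; apply: sA.
- apply: gen_algB; last exact: (ad_stable pres).
  by apply: gen_mul => //; apply: dA.
- rewrite -y_rec -dE {1}(y_rec x eta y j) (brDl poisson) (brNl poisson).
  by rewrite (brMl poisson) (xE a Aa); ring.
by move=> Ajd dq; exists d.
Qed.

End Multiplier.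

Section SameLevelNormal.
Variables (K : fieldType) (charK0 : has_pchar0 K) (r N : nat).
Variables (R : comAlgType K) (br : R -> R -> R).
Variables (act : {ffun 'I_r -> K} -> R -> R) (x x' : 'I_N -> R).
Variables (sigma delta sigma' delta' : 'I_N -> R -> R).
Variables (k k1 : 'I_N) (eta eta' : 'I_N -> int) (y y' : 'I_N -> R).
Hypothesis k1E : nat_of_ord k1 = k.+1.
Hypothesis xE : forall j, x' j = x (tperm k k1 j).
Hypothesis pres : is_pcgl br act x sigma delta.
Hypothesis assoc : associated br act x eta y.
Hypothesis pres' : is_pcgl br act x' sigma' delta'.
Hypothesis assoc' : associated br act x' eta' y'.
Hypothesis eta_eq : eta k = eta k1.
Local Notation A := (partial_alg x).
Local Notation A' := (partial_alg x').
Local Notation q := (y_pred eta y k).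
Let u := y k * y' k - q * y k1.
Let chain := pcgl_chain pres.
Let full := pcgl_full pres.
Let poisson := pcgl_poisson pres.

Let xE' j : x j = x' (tperm k k1 j).
Proof. by rewrite xE tpermK. Qed.
Let x'k : x' k = x k1. Proof. by rewrite xE tpermL. Qed.
Let x'k1 : x' k1 = x k. Proof. by rewrite xE tpermR. Qed.
Let k_ne : (k : nat) != k.+1. Proof. by rewrite -[k.+1]addn1; lia. Qed.
Let p_k1 : eta_pred eta k1 = Some k. Proof. exact: pred_k1. Qed.
Let p'_k1 : eta_pred eta' k1 = Some k.
Proof. exact/(pred_k1 k1E)/(same_level k1E xE pres assoc pres' assoc'). Qed.
Let yE j : j != k -> y' j = y j.
Proof. by move: j; case: (identify_same k1E xE pres assoc pres' assoc' eta_eq). Qed.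
Let k1k : k1 != k.
Proof. by apply/eqP=> /(congr1 val); rewrite /= k1E; lia. Qed.

Let q'E : y_pred eta' y' k = q.
Proof.
have [_ pE] := identify_same k1E xE pres assoc pres' assoc' eta_eq.
rewrite /y_pred pE; case pk: (eta_pred eta k) => [i|] //; apply: yE.
by apply/eqP=> ik; have := eta_pred_lt pk; rewrite ik ltnn.
Qed.

Let ykE : y k = q * x k + - y_tail x eta y k := y_rec x eta y k.
Let y'kE : y' k = q * x k1 + - y_tail x' eta' y' k.
Proof. by rewrite [LHS](y_rec x' eta' y' k) q'E x'k. Qed.
Let yk1E : y k1 = y k * x k1 + - y_tail x eta y k1.
Proof. by rewrite [LHS](y_rec x eta y k1) /y_pred p_k1. Qed.
Let yk1E' : y k1 = y' k * x k + - y_tail x' eta' y' k1.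
Proof. by rewrite -(yE k1k) [LHS](y_rec x' eta' y' k1) /y_pred p'_k1 x'k1. Qed.

(** The terms of highest degree cancel in x_(k+1) by the first presentation and
    in x_k by the second one. *)
Lemma u_mem : A k u.
Proof.
apply: (swap_inter k1E xE pres pres').
  have -> : u = q * y_tail x eta y k1 - y k * y_tail x' eta' y' k.
    by rewrite /u y'kE yk1E; ring.
  have up a : A k a -> A k1 a := up_k1 k1E (a := a).
  apply: gen_algB; apply: gen_mul.
  - exact/up/(y_pred_mem assoc).
  - exact: (y_tail_mem assoc).
  - exact: (y_k_mem k1E assoc).
  - exact/up/(swap_sub k1E xE k_ne)/(y_tail_mem assoc').
have -> : u = q * y_tail x' eta' y' k1 - y' k * y_tail x eta y k.
  by rewrite /u yk1E' {1}ykE; ring.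
have up a : A' k a -> A' k1 a := up_k1 k1E (a := a).
apply: gen_algB; apply: gen_mul.
- by apply/up; rewrite -q'E; apply: (y_pred_mem assoc').
- exact: (y_tail_mem assoc').
- exact: (y_k_mem k1E assoc').
- exact/up/(swap_sup k1E xE k_ne)/(y_tail_mem assoc).
Qed.

(** If u vanished, the prime y_(k+1) would divide y_k or y'_k, but these do not
    involve x_(k+1), respectively x_k. *)
Lemma u_neq0 : u <> 0.
Proof.
move=> /eqP; rewrite subr_eq0 => /eqP uE.
have k2_ne : k1.+1 != k.+1 by rewrite k1E; lia.
have pr := y_prime assoc (leqnn k1) (succ_gt_self eta k1).
have Ayk : A k1.+1 (y k).
  exact: partial_alg_mono (leqnSn k1) (y_k_mem k1E assoc).
have Ay'k : A k1.+1 (y' k).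
  apply: (swap_sub k1E xE k2_ne).
  exact: partial_alg_mono (leqnSn k1) (y_k_mem k1E assoc').
have [|[b Ab ykb]|[b Ab ykb]] := prime_domain pr Ayk Ay'k.
- exists q => //; apply: partial_alg_mono (y_pred_mem assoc k).
  by rewrite k1E; lia.
- exact: (y_not_divisor pres assoc (y_k_mem k1E assoc)
    (@y_neq0 _ _ _ _ _ _ _ _ _ assoc k) Ab ykb).
rewrite -(yE k1k) in ykb.
exact: (y_not_divisor pres' assoc' (y_k_mem k1E assoc')
  (@y_neq0 _ _ _ _ _ _ _ _ _ assoc' k) (swap_sup k1E xE k2_ne Ab) ykb).
Qed.

Lemma u_homogeneous : homogeneous act u.
Proof.
right; split=> [|h th]; first exact: u_neq0.
have action := pcgl_action pres.
have [a qa] := homogeneous_eigen action th (y_pred_homogeneous pres assoc k).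
have [_ /(_ h th) [b xb]] := pcgl_eigen pres k.
have [_ /(_ h th) [c xc]] := pcgl_eigen pres k1.
have [yk _] := y_eigenvalue pres assoc th qa xb.
have [y'k _] : act h (y' k) = (a * c) *: y' k /\ True.
  by split=> //; apply: (y_eigenvalue pres' assoc' th _ _).1; rewrite ?q'E ?x'k.
have [yk1 _] : act h (y k1) = (a * b * c) *: y k1 /\ True.
  split=> //; apply: (y_eigenvalue pres assoc th _ xc).1.
  by rewrite /y_pred p_k1.
exists (a * a * b * c); rewrite /u (act_sub action) // !(act_mul action) //.
rewrite yk y'k yk1 qa -!scalerAl -!scalerAr !scalerA scalerBr.
by congr (_ *: _ - _ *: _); ring.
Qed.

Lemma ad_derivation_k m : (m <= k1)%N -> ad_derivation_on br (A m).
Proof. by apply: (ad_derivation_below charK0 pres assoc); rewrite p_k1. Qed.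

Lemma sigma_k1 a : A k a -> sigma k1 a = sigma' k a.
Proof.
move=> Aa; have A'a := swap_sup k1E xE k_ne Aa.
have [_ [[sA _ _] _] [[dA _ _] _] xk1E] := pcgl_ore pres k1.
have [_ [[s'A _ _] _] [[d'A _ _] _] x'kE] := pcgl_ore pres' k.
have up b : A' k b -> A k1 b by move/(swap_sub k1E xE k_ne)/(up_k1 k1E).
have Ak1a := up_k1 k1E Aa.
have [] // := linear_inj (chain k1) (sA _ Ak1a) (dA _ Ak1a)
  (up _ (s'A _ A'a)) (up _ (d'A _ A'a)) _.
by rewrite -xk1E // -x'k -x'kE.
Qed.

(** Both products are multiplied by 2 d_q + sigma_k + sigma_(k+1), where d_q is
    the multiplier of y_(p(k)). *)
Lemma common_multiplier a : A k a -> exists2 d, A k d &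
  br (y k * y' k) a = d * (y k * y' k) /\ br (q * y k1) a = d * (q * y k1).
Proof.
move=> Aa; have kk1 : (k <= k1)%N by rewrite k1E.
have [d Ad [ykd dq]] := y_multiplier pres assoc (ad_derivation_k kk1) Aa.
have A'a := swap_sup k1E xE k_ne Aa.
have adA' : ad_derivation_on br (A' k).
  by apply: (ad_derivation_below charK0 pres' assoc') kk1; rewrite p'_k1.
have [d' Ad' [y'kd d'q]] := y_multiplier pres' assoc' adA' A'a.
rewrite q'E -sigma_k1 // in d'q.
have [e Ae [yk1e eq]] := y_multiplier pres assoc
  (ad_derivation_k (leqnn k1)) (up_k1 k1E Aa).
rewrite /y_pred p_k1 ykd in eq.
have yk0 := @y_neq0 _ _ _ _ _ _ _ _ _ assoc k.
have eE : e = d + sigma k1 a.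
  by apply: (chain_mulI chain full yk0); rewrite mulrC eq; ring.
exists (d + d').
  by apply: gen_add => //; apply: (swap_sub k1E xE k_ne).
split; first by rewrite (brMl poisson) ykd y'kd; ring.
rewrite (brMl poisson) yk1e eE.
have -> : br q a = d' * q - q * sigma k1 a by rewrite d'q; ring.
by ring.
Qed.

Lemma u_multiplier a : A k a -> exists2 d, A k d &
  br u a = d * u /\ br (q * y k1) a = d * (q * y k1).
Proof.
move=> /common_multiplier [d Ad [E1 E2]]; exists d => //; split=> //.
by rewrite /u (brDl poisson) (brNl poisson) E1 E2; ring.
Qed.

Lemma u_normal : poisson_normal br (A k) u.
Proof.
by split=> [|a /u_multiplier [d Ad [uE _]]]; [apply: u_mem | exists d].
Qed.

Lemma u_same_way : normalize_same_way br (A k) u (q * y k1).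
Proof.
apply: normalize_same_way_intro.
- exact: (chain_domain chain full).
- by apply: ad_derivation_k; rewrite k1E.
- exact: u_neq0.
- apply: (chain_mul_neq0 chain full).
    exact: (@y_pred_neq0 _ _ _ _ _ _ _ _ _ assoc k).
  exact: (@y_neq0 _ _ _ _ _ _ _ _ _ assoc k1).
exact: u_multiplier.
Qed.

End SameLevelNormal.

(** * Rank, and the exchange of two adjacent variables *)

Lemma lists_primes_rank (K : fieldType) (r N : nat) (R : comAlgType K)
    (br : R -> R -> R) (act : {ffun 'I_r -> K} -> R -> R)
    (x : 'I_N -> R) (sigma delta : 'I_N -> R -> R)
    (eta : 'I_N -> int) (y : 'I_N -> R) (m : 'I_N) :
  is_pcgl br act x sigma delta -> associated br act x eta y ->
  m.+1 = N :> nat -> has_rank br act (num_values eta).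
Proof.
move=> pres [c [_ _ _ /(_ m) [l1 l2 l3]]] mN.
set I := [pred j | _] in l1 l2 l3; rewrite -(num_values_last eta mN) -/I.
have wholeE a : partial_alg x m.+1 a <-> whole a.
  by split=> // _; rewrite mN; apply: (pcgl_full pres).
exists (fun i => y (enum_val i)); split=> [i _|d hd pd|i j _ _ yij].
- have [hi pi] := l1 _ (enum_valP i); split=> //.
  exact: poisson_prime_ext wholeE pi.
- have [|j Ij yE] := l2 d hd.
    by apply: poisson_prime_ext pd => a; apply: iff_sym.
  by exists (enum_rank_in Ij j) => //; rewrite enum_rankK_in.
exact/enum_val_inj/(l3 _ _ (enum_valP i) (enum_valP j) yij).
Qed.

Theorem theorem7p2 (K : fieldType) (charK0 : has_pchar0 K) (r N : nat)
    (R : comAlgType K) (br : R -> R -> R)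
    (act : {ffun 'I_r -> K} -> R -> R)
    (x : 'I_N -> R) (sigma delta sigma' delta' : 'I_N -> R -> R)
    (k k1 : 'I_N) (k1E : nat_of_ord k1 = k.+1)
    (eta eta' : 'I_N -> int) (y y' : 'I_N -> R)
    (pres : is_pcgl br act x sigma delta)
    (delta_scalar : exists c : K, delta k1 (x k) = c%:A)
    (assoc : associated br act x eta y)
    (pres' : is_pcgl br act (fun j => x (tperm k k1 j)) sigma' delta')
    (same_maps : forall j, j != k -> j != k1 ->
       forall b, partial_alg x j b ->
         sigma' j b = sigma j b /\ delta' j b = delta j b)
    (assoc' : associated br act (fun j => x (tperm k k1 j)) eta' y') :
  [/\ (eta k <> eta k1 ->
         [/\ forall j, j != k -> j != k1 -> y' j = y j,
             y' k = y k1
           & y' k1 = y k]),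
      (eta k = eta k1 ->
         let u := y k * y' k - y_pred eta y k * y k1 in
         [/\ homogeneous act u,
             poisson_normal br (partial_alg x k) u,
             normalize_same_way br (partial_alg x k) u (y_pred eta y k * y k1)
           & forall j, j != k -> y' j = y j]),
      associated br act (fun j => x (tperm k k1 j))
        (fun j => eta (tperm k k1 j)) y',
      codom (fun j => eta (tperm k k1 j)) =i codom eta
    & exists n : nat,
        [/\ has_rank br act n,
            num_values eta = n
          & num_values (fun j => eta (tperm k k1 j)) = n]].
Proof.
have xE' j : x (tperm k k1 j) = x (tperm k k1 j) by [].
have pE := eta_pred_swap k1E xE' pres assoc pres' assoc'.
have mN : (N.-1 < N)%N by rewrite ltn_predL (leq_ltn_trans _ (ltn_ord k)).
have codomE := codom_involutive eta (@tpermK _ k k1).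
split=> [eta_ne|eta_eq u||//|].
- have yE j := (identify_distinct k1E xE' pres assoc pres' assoc' eta_ne j).1.
  split=> [j jk jk1||]; rewrite yE ?tpermL ?tpermR //.
  by rewrite tpermD // eq_sym.
- split.
  + exact: (u_homogeneous k1E xE' pres assoc pres' assoc' eta_eq).
  + exact: (u_normal charK0 k1E xE' pres assoc pres' assoc' eta_eq).
  + exact: (u_same_way charK0 k1E xE' pres assoc pres' assoc' eta_eq).
  + by case: (identify_same k1E xE' pres assoc pres' assoc' eta_eq).
- exact: associated_ext pE assoc'.
exists (num_values eta); split=> //; last exact: num_values_eq codomE.
apply: (lists_primes_rank (m := Ordinal mN) pres assoc).
by rewrite /= prednK // (leq_ltn_trans _ (ltn_ord k)).
Qed.
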